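(* For each $p\ge1$ let $(V^*_p,\mathcal P^*_p)$ be an $\mathbb L$-valued random variable with $0<\mathbb E(|\mathcal P^*_p|)\le1$ and $\lim_{p\to\infty}\mathbb E(|\mathcal P^*_p|)=1$, and let $\mathbb P_p$ be the probability on $\Omega$ under which $(\omega_n,n\in\mathbb Z)$ is i.i.d. with common distribution that of $(V^*_p,\mathcal P^*_p)$. Let $\varepsilon_p>0$ with $\varepsilon_p\to0$ and put $\mathcal H_p(t)=\varepsilon_p\mathcal H([pt])$, $\mathbb H_p(t)=\varepsilon_p\mathbb H([pt])$. Fix $t>0$. Assume that: (i) for every $p\ge1$, $\mathbb E(\mathbb Y^*_p)<\infty$, and there exists an integrable random variable $\bar{\mathbb Y}$ with $\mathbb E\bar{\mathbb Y}=0$ such that, as $p\to\infty$, $\mathbb Y^*_p-\mathbb E(\mathbb Y^*_p)$ converges in distribution to $\bar{\mathbb Y}$ and $\mathbb E[(\mathbb Y^*_p-\mathbb E(\mathbb Y^*_p))^+]\to\mathbb E(\bar{\mathbb Y}^+)$; (ii) the sequence $(\mathcal H_p(t),p\ge1)$, with $\mathcal H_p(t)$ considered under $\mathbb P_p$, is tight. Then $\mathbb H_p(t)-\mathbb E(\mathbb Y^*_p)\,\mathcal H_p(t)$ under $\mathbb P_p$ converges in distribution to $0$ as $p\to\infty$.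
   Context: $\mathcal M$ is the set of finite point measures on $(0,\infty)$ (weak topology), $\epsilon_x$ the Dirac mass at $x$, $\mathbf z$ the zero measure. For $\nu\in\mathcal M$, $|\nu|=\nu(0,\infty)$, $\pi(\nu)$ is the supremum of its support ($\pi(\mathbf z)=0$), and $\Upsilon_k(\nu)$ is obtained from $\nu$ by removing its $k$ largest atoms, counted with multiplicity ($\Upsilon_k(\nu)=\mathbf z$ if $k\ge|\nu|$). $\mathcal M^*=\bigcup_{n\ge0}(\mathcal M\setminus\{\mathbf z\})^n$; the empty sequence is identified with $\mathbf z$; $[\cdot,\cdot]$ is concatenation ($\mathbf z$ neutral); $\pi(Y)=\sum_{k=1}^{\mathrm{Len}(Y)}\pi(Y(k))$ for $Y\in\mathcal M^*$ of length $\mathrm{Len}(Y)$. $\mathbb L=\{(v,\nu)\in(0,\infty)\times\mathcal M:v\ge\pi(\nu)\}$, $\Omega=\mathbb L^{\mathbb Z}$, $\omega=(\omega_n)_{n\in\mathbb Z}$ with $\omega_n=(V_n,\mathcal P_n)$; $\mathcal G(\omega)=((1,|\mathcal P_n|\epsilon_1),n\in\mathbb Z)$. $[x]$ is the integer part, $x^+=\max(x,0)$. For $Y\in\mathcal M^*$, $\nu\in\mathcal M$, put $H=\max\{k\ge1:|Y(k)|\ge2\}$ ($\max\emptyset=-\infty$) and $\Phi(Y,\nu)=[Y,\nu]$ if $\nu\ne\mathbf z$; $\Phi(Y,\nu)=(Y(1),\dots,Y(H-1),\Upsilon_1(Y(H)))$ if $\nu=\mathbf z$ and $H\ge1$; $\Phi(Y,\nu)=\mathbf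 z$ otherwise. The spine process is $\mathbb S^0_0=\mathbf z$, $\mathbb S^{n+1}_0=\Phi(\mathbb S^n_0,\mathcal P_n)$. The chronological height process is $\mathbb H(n)=\pi(\mathbb S^n_0)$, $n\ge 0$, and the genealogical height process is $\mathcal H=\mathbb H\circ\mathcal G$. $\mathbb Y^*_p$ is the random variable with law given by $$\mathbb E[f(\mathbb Y^*_p)]=\sum_{k=1}^\infty\sum_{r=0}^{k-1}\frac1k\,\mathbb E\left[f\circ\pi\circ\Upsilon_r(\mathcal P^*_p)\ \middle|\ |\mathcal P^*_p|=k\right]\times\frac{k\,\mathbb P(|\mathcal P^*_p|=k)}{\mathbb E(|\mathcal P^*_p|)}$$ for bounded measurable $f$. *)

(* Defs.v *)
From HB Require Import structures.
From mathcomp Require Import all_boot all_order all_algebra.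
From mathcomp Require Import all_classical all_reals all_analysis.

Set Implicit Arguments.
Unset Strict Implicit.
Unset Printing Implicit Defensive.

Import Order.TTheory GRing.Theory Num.Theory.
Import numFieldNormedType.Exports.

Local Open Scope classical_set_scope.
Local Open Scope ring_scope.

(** * Finite point measures on (0, +oo) *)

(* A finite point measure on (0, +oo) is a finite sum of Dirac masses; it is
   encoded by the list of its atoms, repeated according to multiplicity and
   listed in nonincreasing order, which makes the encoding unique.  The measure
   itself is [pm_measure] below. *)
Definition is_atoms (R : realType) (s : seq R) : bool :=
  sorted >=%R s && all (fun x => 0 < x) s.

Record pointm (R : realType) :=
  PointM { atoms :> seq R; atomsP : is_atoms atoms }.

HB.instance Definition _ (R : realType) := [isSub for @atoms R].
HB.instance Definition _ (R : realType) := [Choice of pointm R by <:].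

Definition pm0 (R : realType) : pointm R := @PointM R [::] isT.

HB.instance Definition _ (R : realType) := isPointed.Build (pointm R) (pm0 R).

Definition pm_measure (R : realType) (nu : pointm R) :
    {measure set R -> \bar R} :=
  msum (fun i => dirac (nth 0 nu i) : {measure set R -> \bar R})
    (size nu).

Definition pm_mass (R : realType) (nu : pointm R) : nat := size nu.

Lemma pm_massE (R : realType) (nu : pointm R) :
  pm_measure nu `]0, +oo[%classic = ((pm_mass nu)%:R%:E)%E.
Proof.
rewrite /pm_measure /= /msum (eq_bigr (fun=> 1%:E)%E); last first.
  move=> i _; rewrite /= diracE mem_set//= in_itv/= andbT.
  by have /andP[_ /allP] := atomsP nu; apply; exact: mem_nth.
by rewrite sumEFin sumr_const card_ord.
Qed.

(* In the library [sup set0 = 0], which is the convention pi(z) = 0. *)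
Definition pm_sup (R : realType) (nu : pointm R) : R :=
  sup [set x | x \in atoms nu].

Lemma is_atoms_drop (R : realType) (k : nat) (nu : pointm R) :
  is_atoms (drop k nu).
Proof.
have /andP[s0 /allP a0] := atomsP nu; apply/andP; split.
  by apply: (subseq_sorted _ (drop_subseq _ _) s0) => y x z yx zy; exact: le_trans zy yx.
by apply/allP => x /mem_drop /a0.
Qed.

(* Upsilon_k: since atoms are in nonincreasing order, the [k] largest ones
   are the first [k]. *)
Definition upsilon (R : realType) (k : nat) (nu : pointm R) : pointm R :=
  PointM (is_atoms_drop k nu).

Lemma is_atoms_nseq1 (R : realType) (n : nat) : @is_atoms R (nseq n 1).
Proof.
apply/andP; split; last by rewrite all_nseq ltr01 orbT.
by case: n => //= n; elim: n => //= n ->; rewrite lexx.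
Qed.

(* n epsilon_1 *)
Definition pm_nseq1 (R : realType) (n : nat) : pointm R :=
  PointM (is_atoms_nseq1 R n).

Lemma pm_sup_nseq1 (R : realType) (n : nat) : pm_sup (pm_nseq1 R n) <= 1.
Proof.
rewrite /pm_sup; case: n => [|n].
  by rewrite (_ : [set _ | _] = set0) ?sup0 ?ler01//; apply/seteqP; split.
apply: ge_sup; first by exists 1 => /=; rewrite inE eqxx.
by move=> x /=; rewrite -[_ :: _]/(nseq n.+1 1) mem_nseq => /andP[_ /eqP ->].
Qed.

(* The weak topology: the coarsest one for which nu |-> \int f dnu is
   continuous for each bounded continuous f on (0, +oo). *)
Definition weak_test (R : realType) (f : R -> R) : Prop :=
  {within `]0, +oo[%classic, continuous f} /\
  exists M : R, forall x, 0 < x -> `|f x| <= M.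

Definition weak_subbase (R : realType) (i : (R -> R) * set R) :
    set (pointm R) :=
  [set nu : pointm R | i.2 (\int[pm_measure nu]_(x in `]0, +oo[%classic) i.1 x)%R].

HB.instance Definition _ (R : realType) :=
  @isSubBaseTopological.Build (pointm R) ((R -> R) * set R)%type
    [set i | weak_test i.1 /\ open i.2] (@weak_subbase R).

HB.instance Definition _ (R : realType) :=
  Measurable.copy (pointm R) (g_sigma_algebraType (@open (pointm R))).

(** * The space LL of pairs (v, nu) with v >= pi(nu), and Omega *)

Record life (R : realType) := Life {
  life_span : R;
  progeny : pointm R;
  lifeP : 0 < life_span /\ pm_sup progeny <= life_span }.

HB.instance Definition _ (R : realType) := gen_eqMixin (life R).
HB.instance Definition _ (R : realType) := gen_choiceMixin (life R).

(* (1, n epsilon_1) *)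
Definition unit_life (R : realType) (n : nat) : life R :=
  Life (conj (@ltr01 R) (pm_sup_nseq1 R n)).

HB.instance Definition _ (R : realType) :=
  isPointed.Build (life R) (unit_life R 0).

Definition life_pair (R : realType) (l : life R) :
    (R * pointm R)%type :=
  (life_span l, progeny l).

(* LL carries the trace of the product sigma-algebra of (0, +oo) x M. *)
HB.instance Definition _ (R : realType) :=
  Measurable.copy (life R) (g_sigma_algebra_preimageType (@life_pair R)).

Definition Omega (R : realType) := int -> life R.

HB.instance Definition _ (R : realType) := Pointed.on (Omega R).

HB.instance Definition _ (R : realType) :=
  Measurable.copy (Omega R) (g_sigma_algebraType
    (\bigcup_n preimage_set_system setT
       (fun w : Omega R => w n) (@measurable _ (life R)))).

Definition genea (R : realType) (w : Omega R) : Omega R :=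
  fun n => unit_life R (pm_mass (progeny (w n))).

(** * The spine process and the height processes *)

(* M^* is the set of sequences all of whose entries differ from z. *)
Definition in_Mstar (R : realType) (Y : seq (pointm R)) : bool :=
  all (fun nu => nu != pm0 R) Y.

Definition pi_seq (R : realType) (Y : seq (pointm R)) : R :=
  \sum_(nu <- Y) pm_sup nu.

(* H, with 0 in place of max(emptyset) = -oo: the entry Y(k), k >= 1, is
   [nth _ Y k.-1]. *)
Definition last_branching (R : realType) (Y : seq (pointm R)) : nat :=
  \max_(k < size Y | (2 <= pm_mass (nth (pm0 R) Y k))%N) k.+1.

Definition Phi (R : realType) (Y : seq (pointm R)) (nu : pointm R) :
    seq (pointm R) :=
  let H := last_branching Y in
  if nu != pm0 R then rcons Y nu
  else if (1 <= H)%N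
  then rcons (take H.-1 Y) (upsilon 1 (nth (pm0 R) Y H.-1))
  else [::].

Lemma Phi_Mstar (R : realType) (Y : seq (pointm R)) (nu : pointm R) :
  in_Mstar Y -> in_Mstar (Phi Y nu).
Proof.
move=> Y0; rewrite /Phi; case: ifPn => [nu0|_]; first by rewrite /in_Mstar all_rcons nu0.
case: ifPn => // H1; rewrite /in_Mstar all_rcons.
apply/andP; split; last by apply/allP => x /mem_take; exact: (allP Y0).
have : (2 <= pm_mass (nth (pm0 R) Y (last_branching Y).-1))%N.
  move: H1; rewrite /last_branching; elim/big_ind: _ => //.
  by move=> x y hx hy; rewrite /maxn; case: ifP.
apply: contraTneq => /(congr1 (size \o @atoms R))/=.
rewrite /pm_mass size_drop => /eqP; rewrite subn_eq0 -ltnNge.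
by [].
Qed.

Fixpoint spine (R : realType) (w : Omega R) (n : nat) : seq (pointm R) :=
  if n is m.+1 then Phi (spine w m) (progeny (w m%:Z)) else [::].

Definition chron_height (R : realType) (w : Omega R) (n : nat) : R :=
  pi_seq (spine w n).

Definition genea_height (R : realType) (w : Omega R) (n : nat) : R :=
  chron_height (genea w) n.

(** * Probability *)

(* [X] is a family, indexed by Z, of i.i.d. random elements under [P], with the
   same law as [X0] under [Q]. *)
Definition iid_as d0 (T0 : measurableType d0) d1 (T1 : measurableType d1)
    d (T : measurableType d) (R : realType)
    (P : probability T0 R) (X : int -> T0 -> T)
    (Q : probability T1 R) (X0 : {mfun T1 >-> T}) : Prop :=
  (forall (s : seq int) (A : int -> set T), uniq s ->
     (forall n, measurable (A n)) ->
     P (\bigcap_(n in [set` s]) (X n @^-1` A n)) =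
       (\prod_(n <- s) P (X n @^-1` A n))%E) /\
  (forall (n : int) (A : set T), measurable A ->
     P (X n @^-1` A) = distribution Q X0 A).

(* E[X | A] for an event A; it is 0 when A is null. *)
Definition cond_exp_event d (T : measurableType d) (R : realType)
    (P : probability T R) (X : T -> R) (A : set T) : R :=
  fine (\int[P]_(w in A) (X w)%:E)%E / fine (P A).

(* [Y] has the law of Y^*, built from the LL-valued random variable [X]. *)
Definition has_law_Ystar d (T : measurableType d) d' (T' : measurableType d')
    (R : realType) (P : probability T R) (X : {mfun T >-> life R})
    (P' : probability T' R) (Y : {RV P' >-> R}) : Prop :=
  let nu w := progeny (X w) in
  let mean := fine ('E_P[fun w => (pm_mass (nu w))%:R])%E in
  forall f : R -> R, measurable_fun setT f ->
    (exists M : R, forall x, `|f x| <= M) ->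
    'E_P'[f \o Y]%E =
    (\sum_(1 <= k <oo)
      (\sum_(0 <= r < k)
         k%:R^-1
         * cond_exp_event P (fun w => f (pm_sup (upsilon r (nu w))))
             [set w | pm_mass (nu w) = k]
         * (k%:R * fine (P [set w | pm_mass (nu w) = k]) / mean))%:E)%E.

(* X_p, defined on its own probability space for each p, converges in
   distribution to a random variable with law [mu]. *)
Definition cvg_in_distribution (R : realType)
    (d : nat -> measure_display) (T : forall p, measurableType (d p))
    (P : forall p, probability (T p) R) (X : forall p, T p -> R)
    (mu : probability R R) : Prop :=
  forall f : R -> R, continuous f -> (exists M : R, forall x, `|f x| <= M) ->
    'E_(P p)[f \o X p]%E @[p --> \oo] --> (\int[mu]_x (f x)%:E)%E.

(* Tightness of the sequence (X_p, p >= 1). *)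
Definition tight (R : realType)
    (d : nat -> measure_display) (T : forall p, measurableType (d p))
    (P : forall p, probability (T p) R) (X : forall p, T p -> R) : Prop :=
  forall e : R, 0 < e -> exists K : R, forall p, (1 <= p)%N ->
    (P p [set w | (K < `|X p w|)%R] <= e%:E)%E.

(* Main.v *)
Require Import Defs.
From HB Require Import structures.
From mathcomp Require Import all_boot all_order all_algebra.
From mathcomp Require Import all_classical all_reals all_analysis.
From mathcomp Require Import measurable_realfun ring lra.

Import Order.TTheory GRing.Theory Num.Theory.
Import numFieldNormedType.Exports.

Local Open Scope classical_set_scope.
Local Open Scope ring_scope.

(** The spine at time [n] can be read off the offspring measures
[P_(n-1), P_(n-2), ..., P_0] taken backwards in time.  Carry a counter [r],
equal to [0] at first, of the subtrees completed since the individual under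
inspection was born.  If that individual has more than [r] children, then
[Upsilon_r P] is an entry of the spine, a record, and the counter restarts from
[0], since everything older is untouched; if not, all its children are used up
and the counter becomes [r + 1 - |P|].  Hence the genealogical height is the
number of records, the chronological height is the sum of their values
[pi (Upsilon_r P)], and the difference of the theorem is [eps_p] times the sum
of the recentred record values ([spine_scan], [genea_heightE], [chain_sum]).

The offspring measures are i.i.d., so the counter is a Markov chain restarted
at each record; its record values behave as i.i.d. copies of [Ystar], except that
in the subcritical case there may be no further record.  That [Ystar] is the right
law rests on one fact: a step of the counter without record maps the counting
measure on the states to the counting measure on the positive ones.  It yields that
the mean reward collected at the first record from state [0] is at most the sum
over [r] of the rewards of a record in state [r], that is [E|P| E f(Ystar)] for the
reward [f] ([first_reward_le_total], [total_reward_le]); and, as [E|P| <= 1],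
that there is a record at all with probability at least [E|P|]
([potential_one_ge]).  Comparing [f] with [1 - f] turns the inequality into an
equality when [0 <= f <= 1].  The consequence used is that a bounded [f] with
[E f(Ystar) = 0] has a bounded potential [h], the mean reward at the first record
as a function of the counter, with [h 0 = 0] ([centered_potential]).

For such rewards bounded by [1], with [c] the number of records and [x] the sum
of the rewards so far, [x ^ 2 + 2 x h(r) + (K - c) + 1], killed once [c] exceeds
[K], is a supermartingale.  The sum of bounded centred record values thus has a second
moment of order [K] over at most [K] records ([centered_deviation]); a
nonnegative reward [b] has likewise a first moment of order [K E b(Ystar)]
([nonneg_deviation]).

The rest is the weak law of large numbers for triangular arrays.  By tightness,
up to an event of small probability, the number of records is at most
[K = O(1 / eps_p)].  Truncate [Ystar - E Ystar] at level [M].  The bounded part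
contributes [eps_p] times a quantity with second moment of order [M ^ 2 K],
which tends to [0].  The excess contributes at most
[eps_p K E (|Ystar - E Ystar| - M)^+], and hypothesis (i) makes this small uniformly
in [p] once [M] is large: as [Z = Ystar - E Ystar] is centred,
[E (|Z| - M)^+ = 2 E Z^+ - E min(|Z|, M)], and both terms converge
([excess_uniformly_small], [height_deviation]). *)

Set Implicit Arguments.
Unset Strict Implicit.
Unset Printing Implicit Defensive.

(** * The spine read backwards in time *)

Section spine_scan.
Context {R : realType}.
Implicit Types (Y l : seq (pointm R)) (nu : pointm R).

Lemma pm_mass_eq0 nu : (pm_mass nu == 0)%N = (nu == pm0 R).
Proof.
apply/idP/eqP => [/nilP h|->//]; apply: val_inj; exact: h.
Qed.

Lemma pm_mass_upsilon r nu : pm_mass (upsilon r nu) = (pm_mass nu - r)%N.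
Proof. by rewrite /pm_mass size_drop. Qed.

Lemma upsilon0 nu : upsilon 0 nu = nu.
Proof. by apply: val_inj; rewrite /= drop0. Qed.

Lemma upsilonD r s nu : upsilon r (upsilon s nu) = upsilon (r + s) nu.
Proof. by apply: val_inj; rewrite /= drop_drop. Qed.

(** One step of the spine process at a childless individual, that is when a
subtree has just been completed. *)
Definition prune Y := Phi Y (pm0 R).

(** The spine computed from the most recent offspring measure to the oldest,
[r] being the number of subtrees completed since the individual at the head of
[l] was born. *)
Fixpoint scan (r : nat) l : seq (pointm R) :=
  if l is nu :: l' then
    if (r < pm_mass nu)%N then rcons (scan 0 l') (upsilon r nu)
    else scan (r.+1 - pm_mass nu) l'
  else [::].

Fixpoint history (w : Omega R) (n : nat) : seq (life R) :=
  if n is m.+1 then w m%:Z :: history w m else [::].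

Lemma last_branching_rcons Y nu :
  last_branching (rcons Y nu) =
  if (2 <= pm_mass nu)%N then (size Y).+1 else last_branching Y.
Proof.
rewrite /last_branching.
rewrite -(big_mkord (fun k => (2 <= pm_mass (nth (pm0 R) (rcons Y nu) k))%N) (fun k => k.+1)).
rewrite -(big_mkord (fun k => (2 <= pm_mass (nth (pm0 R) Y k))%N) (fun k => k.+1)).
rewrite size_rcons big_mkcond big_nat_recr//= nth_rcons ltnn eqxx.
rewrite [in RHS]big_mkcond /=.
have -> : (\max_(0 <= i < size Y)
             (if (1 < pm_mass (nth (pm0 R) (rcons Y nu) i))%N then i.+1 else 0) =
          \max_(0 <= i < size Y)
             (if (1 < pm_mass (nth (pm0 R) Y i))%N then i.+1 else 0))%N.
  by apply: eq_big_nat => i /andP[_ iY]; rewrite nth_rcons iY.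
case: ifPn => _; last by rewrite maxn0.
apply/maxn_idPr; apply: leqW; rewrite big_mkord; apply/bigmax_leqP => i _.
by case: ifP.
Qed.

Lemma last_branching_le Y : (last_branching Y <= size Y)%N.
Proof. by apply/bigmax_leqP => i _; exact: ltn_ord. Qed.

Lemma prune_rcons_ge2 Y nu : (2 <= pm_mass nu)%N ->
  prune (rcons Y nu) = rcons Y (upsilon 1 nu).
Proof.
move=> h; rewrite /prune /Phi eqxx /= last_branching_rcons h /=.
by rewrite nth_rcons ltnn eqxx -(cats1 Y nu) take_size_cat.
Qed.

(** An individual with a single child left disappears from the spine together
with that child, so the completed subtree is charged to an older ancestor. *)
Lemma prune_rcons_le1 Y nu : (pm_mass nu <= 1)%N -> prune (rcons Y nu) = prune Y.
Proof.
move=> h; rewrite /prune /Phi eqxx last_branching_rcons [(1 < pm_mass nu)%N]ltnNge h /=.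
case: ifPn => // H1; have HY : ((last_branching Y).-1 < size Y)%N.
  by rewrite prednK// last_branching_le.
by rewrite nth_rcons HY -(cats1 Y nu) takel_cat// ltnW.
Qed.

Lemma iter_prune_rcons r Y nu : (r < pm_mass nu)%N ->
  iter r prune (rcons Y nu) = rcons Y (upsilon r nu).
Proof.
elim: r => [_|r IH rn]; first by rewrite upsilon0.
rewrite iterS IH; last exact: ltnW.
by rewrite prune_rcons_ge2 ?upsilonD// pm_mass_upsilon ltn_subRL addn1.
Qed.

(** The recursion of [scan]: adding an individual and completing [r] subtrees
either uses [r] of its children, or uses them all and leaves
[r + 1 - |nu|] completions to its ancestors; the [1] is the subtree of the
individual itself. *)
Lemma iter_prune_Phi r Y nu :
  iter r prune (Phi Y nu) =
  if (r < pm_mass nu)%N then rcons Y (upsilon r nu)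
  else iter (r.+1 - pm_mass nu) prune Y.
Proof.
have [->|nu0] := eqVneq nu (pm0 R).
  by rewrite (_ : pm_mass (pm0 R) = 0%N)// ltn0 subn0 iterSr.
rewrite /Phi nu0; case: ltnP => h; first exact: iter_prune_rcons.
have m0 : (0 < pm_mass nu)%N by rewrite lt0n pm_mass_eq0.
rewrite -[in LHS](subnK h) -{2}(prednK m0) addnS -addSn iterD.
rewrite iter_prune_rcons ?prednK// iterSr prune_rcons_le1.
  by rewrite -iterSr subSn.
by rewrite pm_mass_upsilon; case: (pm_mass nu) m0 => // k _; rewrite subSnn.
Qed.

(** The statement is for every [r] because the induction on [n] changes the
counter. *)
Lemma scan_spine (w : Omega R) n r :
  scan r [seq progeny x | x <- history w n] = iter r prune (spine w n).
Proof.
elim: n r => [|n IH] r /=; last by rewrite iter_prune_Phi !IH.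
by elim: r => //= r <-; rewrite /prune /Phi eqxx /last_branching big_ord0.
Qed.

Lemma spine_scan w n : spine w n = scan 0 [seq progeny x | x <- history w n].
Proof. by rewrite scan_spine. Qed.

(** Both spines have entries of the same masses, and each entry of the
genealogical one has all its atoms at [1]. *)
Lemma genea_heightE w n :
  genea_height w n = (size (scan 0 [seq progeny x | x <- history w n]))%:R.
Proof.
rewrite /genea_height /chron_height spine_scan.
elim: n 0%N => [|n IH] r /=; first by rewrite /pi_seq big_nil.
have mE k : pm_mass (pm_nseq1 R k) = k by rewrite /pm_mass size_nseq.
rewrite mE; case: ifPn => [h|_]; last exact: IH.
rewrite /pi_seq -cats1 big_cat big_seq1 /= -/(pi_seq _) IH size_rcons -natr1.
congr (_ + _); rewrite /pm_sup /= drop_nseq.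
rewrite (_ : [set x | _] = [set 1]) ?sup1//.
apply/seteqP; split=> x /=; rewrite mem_nseq subn_gt0 h; first by move/eqP.
by move=> ->; rewrite eqxx.
Qed.
End spine_scan.

(** * Chains driven by independent inputs *)

Section driven_chain.
Context dS (S : measurableType dS) dT (T : measurableType dT)
  dO (O : measurableType dO) (R : realType) (I : choiceType).
Variables (P : probability O R) (mu : probability T R) (W : I -> {mfun O >-> T}).
Hypothesis indepW : forall (s : seq I) (A : I -> set T), uniq s ->
  (forall n, measurable (A n)) ->
  P (\bigcap_(n in [set` s]) (W n @^-1` A n)) = (\prod_(n <- s) mu (A n))%E.
Variables (phi : S -> T -> S) (s0 : S).
Hypothesis mphi : measurable_fun setT (fun z : S * T => phi z.1 z.2).

Definition run (js : seq I) (w : O) : S := foldl phi s0 [seq W j w | j <- js].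

Lemma run_rcons js j w : run (rcons js j) w = phi (run js w) (W j w).
Proof. by rewrite /run map_rcons foldl_rcons. Qed.

Lemma measurable_run js : measurable_fun setT (run js).
Proof.
elim/last_ind: js => [|js j IH]; first exact: measurable_cst.
rewrite (_ : run (rcons js j) = (fun z : S * T => phi z.1 z.2) \o
   (fun w => (run js w, W j w))); last by apply/funext => w; rewrite run_rcons.
by apply: measurableT_comp => //; exact: measurable_fun_pair.
Qed.

Definition cylinder (ks : seq I) (A : I -> set T) : set O :=
  \bigcap_(n in [set` ks]) (W n @^-1` A n).

Lemma measurable_cylinder ks A : (forall n, measurable (A n)) ->
  measurable (cylinder ks A).
Proof.
move=> mA; apply: fin_bigcap_measurable => [|k _]; first exact: finite_seq.
exact: measurable_funPTI.
Qed.

Lemma cylinder_cons k ks A :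
  cylinder (k :: ks) A = W k @^-1` A k `&` cylinder ks A.
Proof.
rewrite /cylinder; apply/seteqP; split=> [w h|w [h1 h2] i /=].
  split; first by apply: h => /=; exact: mem_head.
  by move=> i /= ik; apply: h => /=; rewrite inE ik orbT.
by rewrite inE => /orP[/eqP->//|]; exact: h2.
Qed.

Let mrun js : {mfun O >-> S} :=
  HB.pack (run js) (isMeasurableFun.Build _ _ _ _ _ (measurable_run js)).

Let mpair js j : {mfun O >-> (S * T)%type} :=
  HB.pack (fun w => (run js w, W j w))
    (isMeasurableFun.Build _ _ _ _ _
      (measurable_fun_pair (measurable_run js) (measurable_funPT (W j)))).

Let cyl_consE j ks A : uniq (j :: ks) -> (forall n, measurable (A n)) ->
  (P (cylinder (j :: ks) A) = mu (A j) * P (cylinder ks A))%E.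
Proof.
move=> ujks mA; rewrite /cylinder !indepW//= ?big_cons//.
by case/andP: ujks.
Qed.

Let run_pair_cylinder js j ks A X : j \notin ks -> uniq ks ->
  (forall n, measurable (A n)) -> measurable X ->
  (forall A B, (forall n, measurable (A n)) -> measurable B ->
     P (run js @^-1` B `&` cylinder (j :: ks) A) =
     P (run js @^-1` B) * P (cylinder (j :: ks) A))%E ->
  P ((fun w => (run js w, W j w)) @^-1` X `&` cylinder ks A) =
  (P (cylinder ks A) * (distribution P (mrun js) \x mu) X)%E.
Proof.
move=> jks uks mA mX IH.
have mC := measurable_cylinder ks mA.
have c0 : 0 <= fine (P (cylinder ks A)) by exact: fine_ge0.
pose c := NngNum c0.
have cE : c%:num%:E = P (cylinder ks A) by rewrite /= fineK// fin_num_measure.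
pose m := pushforward (mrestr P mC) (mpair js j).
have mE : (mscale c (distribution P (mrun js)) \x mu)%E X = m X.
  apply: product_measure_unique => // B1 B2 mB1 mB2.
  (* the rectangle [B1 * B2] prescribes the input [j], hence joins the cylinder *)
  pose A' k := if k == j then B2 else A k.
  have A'E : cylinder ks A' = cylinder ks A.
    apply: eq_bigcapr => k /= kks; rewrite /A'; case: eqP => // kj.
    by move: jks; rewrite -kj kks.
  have mA' k : measurable (A' k) by rewrite /A'; case: ifP.
  transitivity (P (run js @^-1` B1 `&` cylinder (j :: ks) A')).
    rewrite cylinder_cons A'E /m /pushforward /mrestr /=; congr (P _).
    by rewrite setIA /A' eqxx.
  rewrite IH// cyl_consE//=; last by rewrite jks.
  rewrite A'E /A' eqxx /mscale [in RHS]cE /= /distribution /pushforward.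
  by rewrite (muleC (mu B2)) muleA (muleC (P _)).
transitivity (m X); first by [].
rewrite -mE -cE /product_measure1 ge0_integral_mscale//.
exact: measurable_fun_xsection.
Qed.

(** The chain after the inputs [js] is independent of all other inputs.  One more
input is added by identifying the law of the pair (state, next input) with a
product measure, which rectangles determine; independence from cylinders, and
not only from the next input, is what the induction carries. *)
Lemma run_indep_cylinder js ks A B : uniq (js ++ ks) ->
  (forall n, measurable (A n)) -> measurable B ->
  (P (run js @^-1` B `&` cylinder ks A) =
   P (run js @^-1` B) * P (cylinder ks A))%E.
Proof.
elim/last_ind: js ks A B => [|js j IH] ks A B; last first.
  rewrite cat_rcons => u mA mB.
  pose X : set (S * T) := (fun z : S * T => phi z.1 z.2) @^-1` B.
  have mX : measurable X by rewrite -[X]setTI; exact: mphi.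
  have XE : run (rcons js j) @^-1` B = (fun w => (run js w, W j w)) @^-1` X.
    by apply/seteqP; split=> w; rewrite /preimage /= run_rcons.
  move: (u); rewrite cat_uniq => /and3P[ujs _ /= /andP[jks uks]].
  have u0 : uniq (js ++ [:: j]).
    by move: u; rewrite -cat_rcons cat_uniq cats1 => /and3P[].
  rewrite XE (run_pair_cylinder jks uks mA mX); last by move=> *; exact: IH.
  have := @run_pair_cylinder js j [::] A X isT isT mA mX.
  rewrite /cylinder set_nil bigcap_set0 setIT probability_setT mul1e => ->.
    by rewrite muleC.
  by move=> *; exact: IH.
rewrite /run /= => _ mA mB; have [s0B|s0B] := pselect (B s0).
  rewrite (_ : _ @^-1` _ = setT) ?setTI ?probability_setT ?mul1e//.
  by apply/seteqP; split.
rewrite (_ : _ @^-1` _ = set0) ?set0I ?measure0 ?mul0e//.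
by apply/seteqP; split.
Qed.

Lemma integral_run_rcons js j (V : S -> \bar R) : uniq (rcons js j) ->
  measurable_fun setT V -> (forall s, 0 <= V s)%E ->
  (\int[P]_w V (run (rcons js j) w) =
   \int[P]_w \int[mu]_l V (phi (run js w) l))%E.
Proof.
move=> u mV V0.
have mVphi : measurable_fun setT (fun z : S * T => V (phi z.1 z.2)).
  exact: (measurableT_comp mV).
have mI : measurable_fun setT (fun s => \int[mu]_l V (phi s l))%E.
  exact: (measurable_fun_fubini_tonelli_F (fun z : S * T => V (phi z.1 z.2))).
transitivity (\int[distribution P (mpair js j)]_z V (phi z.1 z.2))%E.
  rewrite ge0_integral_distribution//.
  by apply: eq_integral => w _; rewrite run_rcons.
transitivity (\int[distribution P (mrun js) \x mu]_z V (phi z.1 z.2))%E.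
  apply: eq_measure_integral => X mX _.
  have := @run_pair_cylinder js j [::] (fun=> setT) X isT isT (fun=> measurableT) mX.
  rewrite /cylinder set_nil bigcap_set0 setIT probability_setT mul1e; apply.
  by move=> A B mA mB; apply: run_indep_cylinder; rewrite ?cats1.
rewrite fubini_tonelli1//.
by rewrite ge0_integral_distribution// => s; exact: integral_ge0.
Qed.

(** For a nonnegative function of the state the one-step inequality integrates by
Tonelli, with no integrability condition. *)
Lemma supermartingale_run js (V : S -> \bar R) : uniq js ->
  measurable_fun setT V -> (forall s, 0 <= V s)%E ->
  (forall s, \int[mu]_l V (phi s l) <= V s)%E ->
  (\int[P]_w V (run js w) <= V s0)%E.
Proof.
move=> + mV V0 Vle; elim/last_ind: js => [_|js j IH u].
  by rewrite (eq_integral (cst (V s0)))// integral_cst//= probability_setT mule1.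
rewrite integral_run_rcons//; apply: le_trans (IH _); last first.
  by move: u; rewrite rcons_uniq => /andP[].
have mI : measurable_fun setT (fun s => \int[mu]_l V (phi s l))%E.
  apply: (measurable_fun_fubini_tonelli_F (fun z : S * T => V (phi z.1 z.2))) => //.
  exact: (measurableT_comp mV).
apply: ge0_le_integral => //.
- by move=> w _; exact: integral_ge0.
- exact: (measurableT_comp mI (measurable_run js)).
- exact: (measurableT_comp mV (measurable_run js)).
Qed.
End driven_chain.

(** * Expected reward at the first record *)

Section first_record.
Local Open Scope ereal_scope.
Context dT (T : measurableType dT) (R : realType) (mu : probability T R).
Variable xi : T -> nat.
Hypothesis mxi : measurable_fun setT xi.
Implicit Types (c : nat -> T -> \bar R) (g : nat -> \bar R).

(** One step from the counter [r]: the reward [c] at a record, and [g] of the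
new counter otherwise. *)
Definition jump c g (r : nat) (l : T) : \bar R :=
  if (r < xi l)%N then c r l else g (r.+1 - xi l)%N.

(** Mean of the reward of the first record, if it occurs within [n] steps,
starting from the counter [r]. *)
Fixpoint first_reward c (n r : nat) : \bar R :=
  if n is m.+1 then \int[mu]_l jump c (first_reward c m) r l else 0.

Definition potential c (r : nat) : \bar R := limn (fun n => first_reward c n r).

(** Mean reward of one step when the counter is distributed according to the
counting measure. *)
Definition total_reward c : \bar R :=
  \sum_(r <oo) \int[mu]_l (if (r < xi l)%N then c r l else 0).

Lemma measurable_comp_xi dU (U : measurableType dU) (h : nat -> U) :
  measurable_fun setT (h \o xi).
Proof. by apply: measurableT_comp. Qed.

Lemma measurable_jump c g r : measurable_fun setT (c r) ->
  measurable_fun setT (jump c g r).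
Proof.
move=> mc; apply: measurable_fun_ifT => //.
  exact: (measurable_comp_xi (fun k => r < k)%N).
exact: (measurable_comp_xi (fun k => g (r.+1 - k)%N)).
Qed.

Definition reward c := (forall r, measurable_fun setT (c r)) /\
  (forall r l, 0 <= c r l).

Lemma jump_ge0 c g r l : reward c -> (forall k, 0 <= g k) -> 0 <= jump c g r l.
Proof. by move=> [_ c0] g0; rewrite /jump; case: ifP. Qed.

Lemma first_reward_ge0 c n r : reward c -> 0 <= first_reward c n r.
Proof.
move=> rc; elim: n r => [|n IH] r //=.
by apply: integral_ge0 => l _; exact: jump_ge0.
Qed.

Lemma le_integral_jump c g c' g' r r' : reward c -> reward c' ->
  (forall k, 0 <= g k) -> (forall k, 0 <= g' k) ->
  (forall l, jump c g r l <= jump c' g' r' l) ->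
  \int[mu]_l jump c g r l <= \int[mu]_l jump c' g' r' l.
Proof.
move=> rc rc' g0 g'0 h; apply: ge0_le_integral => //.
- by move=> l _; exact: jump_ge0.
- by apply: measurable_jump; case: rc.
- by apply: measurable_jump; case: rc'.
Qed.

Lemma first_reward_nd c r : reward c -> nondecreasing_seq (fun n => first_reward c n r).
Proof.
move=> rc; apply/nondecreasing_seqP => n; elim: n r => [|n IH] r.
  exact: first_reward_ge0.
apply: (@le_integral_jump c (first_reward c n) c (first_reward c n.+1) r r rc rc) => [k|k|l].
- exact: first_reward_ge0.
- exact: first_reward_ge0.
by rewrite /jump; case: (r < xi l)%N => //; exact: IH.
Qed.

Lemma first_reward_le_potential c n r : reward c -> first_reward c n r <= potential c r.
Proof.
move=> rc; rewrite /potential.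
have /cvg_lim -> // := ereal_nondecreasing_cvgn (first_reward_nd r rc).
by apply: ereal_sup_ubound; exists n.
Qed.

Lemma potential_ub c r x : reward c -> (forall n, first_reward c n r <= x) ->
  potential c r <= x.
Proof.
move=> rc h; apply: lime_le; last exact: nearW.
exact: ereal_nondecreasing_is_cvgn (first_reward_nd r rc).
Qed.

Lemma potential_ge0 c r : reward c -> 0 <= potential c r.
Proof. by move=> rc; exact: le_trans (first_reward_le_potential 0 r rc). Qed.

Lemma cvg_first_reward c r : reward c -> first_reward c n r @[n --> \oo] --> potential c r.
Proof. by move=> rc; exact: ereal_nondecreasing_is_cvgn (first_reward_nd r rc). Qed.

(** First-step analysis, by monotone convergence. *)
Lemma potentialE c r : reward c ->
  potential c r = \int[mu]_l jump c (potential c) r l.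
Proof.
move=> rc; have [mc c0] := rc.
have : first_reward c n.+1 r @[n --> \oo] --> potential c r.
  by have := @cvg_first_reward c r rc; rewrite -cvg_shiftS.
move/cvg_lim => <-//=.
rewrite -monotone_convergence//.
- apply: eq_integral => l _; rewrite /jump; case: ifP => // _.
  by rewrite lim_cst.
- by move=> n; exact: measurable_jump.
- by move=> n l _; apply: jump_ge0 => // k; exact: first_reward_ge0.
- move=> l _ m n mn; rewrite /jump; case: ifP => // _; exact: first_reward_nd.
Qed.

Lemma first_rewardD c c' n r : reward c -> reward c' ->
  first_reward (fun r l => c r l + c' r l) n r = first_reward c n r + first_reward c' n r.
Proof.
move=> rc rc'; elim: n r => [|n IH] r /=; first by rewrite adde0.
rewrite -ge0_integralD//.
- by apply: eq_integral => l _; rewrite /jump; case: ifP.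
- by move=> l _; apply: jump_ge0 => // k; exact: first_reward_ge0.
- by apply: measurable_jump; case: rc.
- by move=> l _; apply: jump_ge0 => // k; exact: first_reward_ge0.
- by apply: measurable_jump; case: rc'.
Qed.

Lemma potentialD c c' r : reward c -> reward c' ->
  potential (fun r l => c r l + c' r l) r = potential c r + potential c' r.
Proof.
move=> rc rc'; apply/cvg_lim => //.
rewrite (_ : (fun n => _) = (fun n => first_reward c n r + first_reward c' n r)); last first.
  by apply/funext => n; exact: first_rewardD.
apply: cvgeD; [|exact: cvg_first_reward|exact: cvg_first_reward].
by apply: ge0_adde_def; rewrite inE; exact: potential_ge0.
Qed.

(** A step with [x] children sends the counters [r >= x] bijectively onto the
positive integers, so it preserves the counting measure away from [0]. *)
Lemma nneseries_guarded_shift g x : (forall k, 0 <= g k) ->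
  \sum_(r <oo) (if (r < x)%N then 0 else g (r.+1 - x)%N) = \sum_(i <oo) g i.+1.
Proof.
move=> g0; rewrite (nneseries_split 0 x)//; last by move=> k _; case: ifP.
rewrite add0n big_nat big1 ?add0e; last by move=> i /andP[_ ->].
rewrite -nneseries_addn; last by move=> i; case: ifP.
by apply: eq_eseriesr => i _; rewrite ltnNge leq_addl/= -addSn addnK.
Qed.

(** Summing the recursion of [first_reward] over all counters gives, by
[nneseries_guarded_shift],
[a_(n+1)(0) + sum_(i > 0) a_(n+1)(i) = total + sum_(i > 0) a_n(i)].
As [a_n] increases with [n], cancelling the sums leaves [a_(n+1)(0) <= total]. *)
Lemma first_reward_le_total c n : reward c -> first_reward c n 0 <= total_reward c.
Proof.
move=> rc; have [mc c0] := rc.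
have t0 r : 0 <= \int[mu]_l (if (r < xi l)%N then c r l else 0).
  by apply: integral_ge0 => l _; case: ifP.
have [->|Boo] := eqVneq (total_reward c) +oo; first exact: leey.
have Bfin : total_reward c < +oo by rewrite ltey.
pose H n := \sum_(i <oo) first_reward c n i.+1.
have H0 m : 0 <= H m by apply: nneseries_ge0 => i _ _; exact: first_reward_ge0.
have HS m : first_reward c m.+1 0 + H m.+1 = total_reward c + H m.
  have -> : first_reward c m.+1 0 + H m.+1 = \sum_(r <oo) first_reward c m.+1 r.
    rewrite [RHS]nneseries_recl//; last by move=> k _; exact: first_reward_ge0.
    congr (_ + _); rewrite -nneseries_addn; last by move=> k; exact: first_reward_ge0.
    by apply: eq_eseriesr => i _; rewrite addn1.
  pose z : nat -> T -> \bar R := fun=> cst 0.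
  have rz : reward z by split=> // r; exact: measurable_cst.
  have -> : H m = \int[mu]_l \sum_(r <oo) jump z (first_reward c m) r l.
    rewrite (eq_integral (cst (H m))); first by rewrite integral_cst//= probability_setT mule1.
    by move=> l _; rewrite /= /H -(nneseries_guarded_shift (xi l))// => k; exact: first_reward_ge0.
  rewrite integral_nneseries//; last 2 first.
  - by move=> r; apply: measurable_jump; case: rz.
  - by move=> r l _; apply: jump_ge0 => // k; exact: first_reward_ge0.
  rewrite /total_reward -nneseriesD//; last first.
    by move=> r _ _; apply: integral_ge0 => l _; apply: jump_ge0 => // k; exact: first_reward_ge0.
  apply: eq_eseriesr => r _ /=; rewrite -ge0_integralD//.
  - by apply: eq_integral => l _; rewrite /jump; case: ifP; rewrite ?adde0 ?add0e.
  - by move=> l _; case: ifP.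
  - exact: (@measurable_jump c (fun=> 0) r).
  - by move=> l _; apply: jump_ge0 => // k; exact: first_reward_ge0.
  - by apply: measurable_jump; case: rz.
have Hfin m : H m < +oo.
  elim: m => [|m IH]; first by rewrite /H eseries0.
  apply: (@le_lt_trans _ _ (total_reward c + H m)); last exact: lte_add_pinfty.
  by rewrite -HS leeDr// first_reward_ge0.
case: n => [|n]; first exact: nneseries_ge0.
rewrite -(@leeD2rE _ (H n.+1)); last by rewrite ge0_fin_numE.
rewrite HS leeD2l//; apply: lee_nneseries => [i _ _|i _]; first exact: first_reward_ge0.
exact: first_reward_nd.
Qed.


Lemma total_rewardE c : reward c -> total_reward c = \int[mu]_l \sum_(0 <= r < xi l) c r l.
Proof.
move=> rc; have [mc c0] := rc; rewrite /total_reward -integral_nneseries//.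
- apply: eq_integral => l _; rewrite (nneseries_split 0 (xi l))//; last first.
    by move=> k _; case: ifP.
  rewrite add0n [X in _ + X]eseries0 ?adde0; last first.
    by move=> i + _; rewrite leqNgt => /negbTE ->.
  by apply: eq_big_nat => i /andP[_ ->].
- by move=> r; exact: (@measurable_jump c (fun=> 0) r).
- by move=> r l _; case: ifP.
Qed.

Lemma integral_cst1 (x : \bar R) : \int[mu]_l (cst x) l = x.
Proof. by rewrite integral_cst//= probability_setT mule1. Qed.

Lemma first_reward_le1 c n r : reward c -> (forall r l, c r l <= 1) -> first_reward c n r <= 1.
Proof.
move=> rc c1; elim: n r => [|n IH] r /=; first exact: lee01.
rewrite -[leRHS]integral_cst1; apply: ge0_le_integral => //.
- by move=> l _; apply: jump_ge0 => // k; exact: first_reward_ge0.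
- by apply: measurable_jump; case: rc.
- by move=> l _; rewrite /jump /=; case: (r < xi l)%N.
Qed.

Lemma potential_le1 c r : reward c -> (forall r l, c r l <= 1) ->
  potential c r <= 1.
Proof. by move=> rc c1; apply: potential_ub => // n; exact: first_reward_le1. Qed.

Lemma potential_fin_num c r : reward c -> (forall r l, c r l <= 1) ->
  potential c r \is a fin_num.
Proof.
move=> rc c1; rewrite ge0_fin_numE; last exact: potential_ge0.
exact: le_lt_trans (potential_le1 r rc c1) (ltry _).
Qed.

Definition one_reward : nat -> T -> \bar R := fun=> cst 1.

Lemma reward1 : reward one_reward.
Proof. by split=> // r; exact: measurable_cst. Qed.

(** From a larger counter it takes more children to make a record. *)
Lemma first_reward_one_anti n r : first_reward one_reward n r.+1 <= first_reward one_reward n r.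
Proof.
have le1 m k : first_reward one_reward m k <= 1 by apply: first_reward_le1 => //; exact: reward1.
elim: n r => [|n IH] r //.
apply: (@le_integral_jump one_reward (first_reward one_reward n) one_reward
  (first_reward one_reward n) r.+1 r reward1 reward1) => [k|k|l].
- exact/first_reward_ge0/reward1.
- exact/first_reward_ge0/reward1.
rewrite /jump; case: (ltnP r.+1 (xi l)) => [/ltnW -> //|]; case: (ltnP r (xi l)).
  by move=> _ _; exact: le1.
by move=> h _; rewrite (subSn (leqW h)); exact: IH.
Qed.

Let U := potential one_reward.

Let Ufin r : U r \is a fin_num.
Proof. exact: potential_fin_num reward1 _. Qed.

Let v r : R := (1 - fine (U r))%R.

Let v_ge0 r : (0 <= v r)%R.
Proof.
rewrite /v subr_ge0 -lee_fin fineK//; apply: potential_le1 => //; exact: reward1.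
Qed.

Let v_le1 r : (v r <= 1)%R.
Proof. by rewrite /v gerBl fine_ge0// potential_ge0//; exact: reward1. Qed.

Let v_nd : {homo v : r s / (r <= s)%N >-> (r <= s)%R}.
Proof.
apply: homo_leq => [//|x y z|r]; first exact: le_trans.
rewrite /v lerD2l lerN2 fine_le//; apply: potential_ub; first exact: reward1.
move=> n; apply: le_trans (first_reward_one_anti n r) _.
exact/first_reward_le_potential/reward1.
Qed.

Let vE r : (v r)%:E = \int[mu]_l (if (r < xi l)%N then 0 else v (r.+1 - xi l)%N)%:E.
Proof.
have mj : measurable_fun setT
    (fun l => (if (r < xi l)%N then 0 else v (r.+1 - xi l)%N)%:E : \bar R).
  exact: (measurable_comp_xi
    (fun k => (if (r < k)%N then 0 else v (r.+1 - k)%N)%:E : \bar R)).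
have : U r + \int[mu]_l (if (r < xi l)%N then 0 else v (r.+1 - xi l)%N)%:E = 1.
  rewrite /U potentialE; last exact: reward1.
  rewrite -ge0_integralD//.
  - rewrite -[RHS]integral_cst1; apply: eq_integral => l _.
    rewrite /jump /=; case: (r < xi l)%N; first by rewrite adde0.
    by rewrite /v -/U EFinB fineK// addeCA subee// adde0.
  - by move=> l _; apply: jump_ge0 => [|k]; [|apply: potential_ge0]; exact: reward1.
  - by apply: measurable_jump; exact: measurable_cst.
  - by move=> l _; rewrite lee_fin; case: ifP.
move=> h; rewrite /v EFinB fineK// -h addeAC subee ?add0e//.
Qed.

(** Pathwise form of the balance below: a step from the counters [0, ..., N]
lands on [1, ..., N + 1 - x], which misses the [min(x, N + 1)] largest counters
of [1, ..., N + 1]. *)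
Let sum_window (x N J : nat) : (J <= N.+1)%N ->
  (\sum_(r < N.+1) (if (r < x)%N then 0 else v (r.+1 - x)%N) +
   (minn x J)%:R * v (N.+2 - J)%N <= \sum_(r < N.+1) v r.+1)%R.
Proof.
move=> JN; set k := minn x J.
have kN : (k <= N.+1)%N by rewrite (leq_trans _ JN)// geq_minr.
have -> : (\sum_(r < N.+1) v r.+1 =
    \sum_(0 <= r < N.+1 - k) v r.+1 + \sum_(N.+1 - k <= r < N.+1) v r.+1)%R.
  by rewrite -big_cat_nat//= ?leq_subr// big_mkord.
apply: lerD; last first.
  have -> : (k%:R * v (N.+2 - J)%N = \sum_(N.+1 - k <= r < N.+1) v (N.+2 - J)%N)%R.
    by rewrite sumr_const_nat subKn// mulr_natl.
  rewrite big_nat [leRHS]big_nat; apply: ler_sum => i /andP[iN _].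
  apply: v_nd; rewrite subSn// ltnS (leq_trans _ iN)// leq_sub2l//.
  by rewrite geq_minr.
have [xN|Nx] := leqP x N.+1; last first.
  rewrite big1 ?sumr_ge0// => i _.
  by rewrite (leq_trans (ltn_ord i) (ltnW Nx)).
rewrite -(big_mkord xpredT (fun r => if (r < x)%N then 0 else v (r.+1 - x)%N)%R).
rewrite (big_cat_nat (n := x))//= big_nat big1 ?add0r; last by move=> i /andP[_ ->].
rewrite -{1}(add0n x) big_addn big_nat.
under eq_bigr => i _ do rewrite ltnNge leq_addl/= -addSn addnK.
rewrite -big_nat (@big_cat_nat _ _ _ (N.+1 - x) 0 (N.+1 - k))//=.
  by rewrite lerDl sumr_ge0.
by rewrite leq_sub2l// geq_minl.
Qed.

(** Integrating [sum_window] and cancelling the terms common to the sums of [v] over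
[0, ..., N] and over [1, ..., N + 1]. *)
Let v0_window N J : (J <= N.+1)%N ->
  (v 0 + fine (\int[mu]_l (minn (xi l) J)%:R%:E) * v (N.+2 - J)%N <= v N.+1)%R.
Proof.
move=> JN.
have mm : measurable_fun setT (fun l => (minn (xi l) J)%:R%:E : \bar R).
  exact: (measurable_comp_xi (fun k => (minn k J)%:R%:E : \bar R)).
have ifin : \int[mu]_l (minn (xi l) J)%:R%:E \is a fin_num.
  rewrite ge0_fin_numE; last by apply: integral_ge0 => l _; rewrite lee_fin.
  apply: (@le_lt_trans _ _ (\int[mu]_l (cst J%:R%:E) l)); last first.
    by rewrite integral_cst1 ltry.
  apply: ge0_le_integral => //.
  by move=> l _; rewrite lee_fin ler_nat geq_minr.
have mS r : measurable_fun setT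
    (fun l => (if (r < xi l)%N then 0 else v (r.+1 - xi l)%N)%:E : \bar R).
  exact: (measurable_comp_xi
    (fun k => (if (r < k)%N then 0 else v (r.+1 - k)%N)%:E : \bar R)).
have S0 r l : 0 <= (if (r < xi l)%N then 0 else v (r.+1 - xi l)%N)%:E :> \bar R.
  by rewrite lee_fin; case: ifP.
suff : (\sum_(r < N.+1) v r + fine (\int[mu]_l (minn (xi l) J)%:R%:E) * v (N.+2 - J)%N
  <= \sum_(r < N.+1) v r.+1)%R.
  by rewrite big_ord_recl [leRHS]big_ord_recr/= addrAC addrC lerD2l.
rewrite -lee_fin EFinD -sumEFin EFinM fineK//.
under eq_bigr do rewrite vE.
rewrite -ge0_integral_sum// -ge0_integralZr//; last by rewrite lee_fin.
rewrite -ge0_integralD//; last 4 first.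
- by move=> l _; exact: sume_ge0.
- exact: emeasurable_sum.
- by move=> l _; rewrite -EFinM lee_fin mulr_ge0.
- by apply: emeasurable_funM => //; exact: measurable_cst.
rewrite -[leRHS]integral_cst1; apply: ge0_le_integral => //.
- by move=> l _; rewrite adde_ge0 ?sume_ge0// -EFinM lee_fin mulr_ge0.
- apply: emeasurable_funD; first exact: emeasurable_sum.
  by apply: emeasurable_funM => //; exact: measurable_cst.
- by move=> l _; rewrite /= sumEFin -EFinM -EFinD lee_fin; exact: sum_window.
Qed.

(** A record occurs with probability at least the mean number of children.  Let
[v r] be the probability that it never occurs from the counter [r]; it is
nondecreasing in [r], and letting [N] tend to infinity in [v0_window] gives
[v 0 <= lim v * (1 - E min(xi, J))] for every [J]. *)
Lemma potential_one_ge : \int[mu]_l (xi l)%:R%:E <= 1 ->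
  \int[mu]_l (xi l)%:R%:E <= potential one_reward 0.
Proof.
move=> m1; rewrite -/U.
have mm J : measurable_fun setT (fun l => (minn (xi l) J)%:R%:E : \bar R).
  exact: (measurable_comp_xi (fun k => (minn k J)%:R%:E : \bar R)).
have mx : measurable_fun setT (fun l => (xi l)%:R%:E : \bar R).
  exact: (measurable_comp_xi (fun k => k%:R%:E : \bar R)).
have cv : cvgn v.
  apply: nondecreasing_is_cvgn => //; exists 1%R => _ [n _ <-]; exact: v_le1.
have vlim r : (v r <= limn v)%R by exact: nondecreasing_cvgn_le.
have lim1 : (limn v <= 1)%R by apply: limr_le => //; apply: nearW.
(* [J] is kept fixed while [N] tends to infinity in [v0_window] *)
have minU J : \int[mu]_l (minn (xi l) J)%:R%:E <= U 0%N.
  have minm : \int[mu]_l (minn (xi l) J)%:R%:E <= 1.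
    apply: le_trans m1; apply: ge0_le_integral => //.
    by move=> l _; rewrite lee_fin ler_nat geq_minl.
  have ifin : \int[mu]_l (minn (xi l) J)%:R%:E \is a fin_num.
    rewrite ge0_fin_numE; last by apply: integral_ge0 => l _; rewrite lee_fin.
    exact: le_lt_trans minm (ltry _).
  set e := fine (\int[mu]_l (minn (xi l) J)%:R%:E).
  have e1 : (e <= 1)%R by rewrite -lee_fin fineK.
  have e0 : (0 <= e)%R by apply/fine_ge0/integral_ge0 => l _; rewrite lee_fin.
  have h : (v 0 + e * limn v <= limn v)%R.
    have cvv : (fun k => v 0 + e * v k)%R @ \oo --> (v 0 + e * limn v)%R.
      by apply: cvgD; [exact: cvg_cst|apply: cvgMr].
    apply: (cvgr_to_le cvv).
    apply: nearW => k; apply: le_trans (vlim (k + J).+1).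
    apply: le_trans (@v0_window (k + J) J _); last by rewrite leqW// leq_addl.
    rewrite lerD2l ler_wpM2l//; apply: v_nd.
    by rewrite -2!addSn addnK -addn2 leq_addr.
  have : (v 0 <= 1 - e)%R.
    apply: (@le_trans _ _ ((1 - e) * limn v)%R); first by rewrite mulrBl mul1r lerBrDr.
    by rewrite ler_piMr// subr_ge0.
  by rewrite -[X in X <= _]fineK// -/e -[U 0%N]fineK// lee_fin /v; lra.
have -> : \int[mu]_l (xi l)%:R%:E = limn (fun J => \int[mu]_l (minn (xi l) J)%:R%:E).
  rewrite -monotone_convergence//.
  - apply: eq_integral => l _; apply/esym/lim_near_cst => //.
    by exists (xi l) => // J /= h; move/minn_idPl : h => ->.
  - by move=> l _ a b ab; rewrite lee_fin ler_nat leq_min geq_minl/= (leq_trans (geq_minr _ _)).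
apply: lime_le; last exact: nearW.
apply: ereal_nondecreasing_is_cvgn => a b ab; apply: ge0_le_integral => //.
by move=> l _; rewrite lee_fin ler_nat leq_min geq_minl/= (leq_trans (geq_minr _ _)).
Qed.

(** The potential of the centred reward [b - e].  Its value at [0] vanishes because
the upper bounds for the rewards [b] and [1 - b] add up to the lower bound for
the reward [1]. *)
Lemma centered_potential (b : nat -> T -> R) (e : R) :
  (forall r, measurable_fun setT (b r)) -> (forall r l, 0 <= b r l <= 1)%R ->
  (0 <= e <= 1)%R ->
  \int[mu]_l (xi l)%:R%:E <= 1 ->
  total_reward (fun r l => (b r l)%:E) <= \int[mu]_l (xi l)%:R%:E * e%:E ->
  total_reward (fun r l => (1 - b r l)%:E) <= \int[mu]_l (xi l)%:R%:E * (1 - e)%:E ->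
  exists h : nat -> R, [/\ (forall r, `|h r| <= 1)%R, h 0%N = 0%R &
    forall r, \int[mu]_l (if (r < xi l)%N then b r l - e else h (r.+1 - xi l)%N)%:E
      = (h r)%:E].
Proof.
move=> mb b01 /andP[e0 e1] m1 tb tb'.
pose c r l := (b r l)%:E; pose c' r l := (1 - b r l)%:E.
have rc : reward c.
  split=> [r|r l]; first exact/measurable_EFinP.
  by rewrite lee_fin; case/andP: (b01 r l).
have rc' : reward c'.
  split=> [r|r l]; first by apply/measurable_EFinP/measurable_funB.
  by rewrite lee_fin subr_ge0; case/andP: (b01 r l).
have c1 r l : c r l <= 1 by rewrite lee_fin; case/andP: (b01 r l).
have c'1 r l : c' r l <= 1 by rewrite lee_fin gerBl; case/andP: (b01 r l).
have hfin := potential_fin_num _ rc c1.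
have h'fin := potential_fin_num _ rc' c'1.
have m0 : 0 <= \int[mu]_l (xi l)%:R%:E by apply: integral_ge0 => l _; rewrite lee_fin.
have mfin : \int[mu]_l (xi l)%:R%:E \is a fin_num.
  by rewrite ge0_fin_numE//; exact: le_lt_trans m1 (ltry _).
pose p r := fine (potential c r); pose q r := fine (U r).
have pE r : potential c r = (p r)%:E by rewrite fineK.
have qE r : U r = (q r)%:E by rewrite fineK.
have sumU r : U r = potential c r + potential c' r.
  rewrite -potentialD//; congr (potential _ r).
  by apply/funext => k; apply/funext => l; rewrite /c /c' -EFinD addrC subrK.
have p0 r : (0 <= p r)%R by rewrite fine_ge0// potential_ge0.
have pq r : (p r <= q r)%R.
  by rewrite -lee_fin -pE -qE sumU leeDl// potential_ge0.
have q1 r : (q r <= 1)%R.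
  by rewrite -lee_fin -qE; apply: potential_le1 => //; exact: reward1.
(* At 0 both upper bounds are attained, because their sum is. *)
have [pm qm] : p 0%N = (q 0%N * e)%R /\ q 0%N = fine (\int[mu]_l (xi l)%:R%:E).
  have Hp : potential c 0 <= \int[mu]_l (xi l)%:R%:E * e%:E.
    by apply: potential_ub => // n; apply: le_trans tb; exact: first_reward_le_total.
  have Hp' : potential c' 0 <= \int[mu]_l (xi l)%:R%:E * (1 - e)%:E.
    by apply: potential_ub => // n; apply: le_trans tb'; exact: first_reward_le_total.
  have HU := potential_one_ge m1.
  move: Hp Hp' HU; rewrite -/U.
  have : potential c' 0 = (q 0 - p 0)%:E.
    by rewrite EFinB -pE -qE sumU addeAC subee ?add0e.
  move=> ->; rewrite pE qE -(fineK mfin) -!EFinM !lee_fin.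
  move: (fine _) => m h1 h2 h3.
  have qm : q 0%N = m by apply/eqP; rewrite eq_le h3 andbT; lra.
  split=> //; rewrite qm in h2 *.
  by apply/eqP; rewrite eq_le; apply/andP; split; lra.
exists (fun r => p r - e * q r)%R; split=> [r||r].
- have := p0 r; have := pq r; have := q1 r => a1 a2 a3.
  by rewrite ler_norml; apply/andP; split; nra.
- by rewrite pm mulrC subrr.
have mjp : measurable_fun setT
    (fun l => if (r < xi l)%N then b r l else p (r.+1 - xi l)%N).
  apply: measurable_fun_ifT => //; first exact: (measurable_comp_xi (fun k => r < k)%N).
  exact: (measurable_comp_xi (fun k => p (r.+1 - k)%N)).
have mjq : measurable_fun setT
    (fun l => if (r < xi l)%N then 1%R else q (r.+1 - xi l)%N).
  apply: measurable_fun_ifT => //; first exact: (measurable_comp_xi (fun k => r < k)%N).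
  exact: (measurable_comp_xi (fun k => q (r.+1 - k)%N)).
have jp01 l : (0 <= (if (r < xi l)%N then b r l else p (r.+1 - xi l)%N) <= 1)%R.
  case: ifP => _; first exact: b01.
  by rewrite p0 (le_trans (pq _)).
have jq01 l : (0 <= (if (r < xi l)%N then 1%R else q (r.+1 - xi l)%N) <= 1)%R.
  case: ifP => _; first by rewrite ler01 lexx.
  by rewrite (le_trans (p0 _) (pq _)) q1.
have ib (f : T -> R) : measurable_fun setT f -> (forall l, 0 <= f l <= 1)%R ->
    mu.-integrable setT (EFin \o f).
  move=> mf f01; apply: measurable_bounded_integrable => //.
    by rewrite (le_lt_trans (probability_le1 _ _)) ?ltry.
  exists 1%R; split=> // M M1 l _ /=; have /andP[f0 f1] := f01 l.
  by rewrite ger0_norm// (le_trans f1)// ltW.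
have Ep := potentialE r rc.
have Eq := potentialE r reward1.
have -> : (p r - e * q r)%:E = potential c r - e%:E * U r by rewrite pE qE.
rewrite /U Ep Eq -/U -integralZl//; last first.
  apply: eq_integrable (ib _ mjq jq01) => // l _ /=; rewrite /jump /=.
  by rewrite -/U qE; case: ifP.
rewrite -integralB//; last 2 first.
- apply: eq_integrable (ib _ mjp jp01) => // l _ /=; rewrite /jump /=.
  by rewrite pE; case: ifP.
- apply: integrableZl => //.
  apply: eq_integrable (ib _ mjq jq01) => // l _ /=; rewrite /jump /=.
  by rewrite -/U qE; case: ifP.
apply: eq_integral => l _; rewrite /jump -/U pE qE; case: ifP => _.
  by rewrite /c /one_reward /= mulr1.
by rewrite -EFinM -EFinB.
Qed.

End first_record.

(** * Supermartingales of the record chain *)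

Lemma measurable_nat_pair dT (T : measurableType dT) dU (U : measurableType dU)
    (g : nat -> T -> U) : (forall n, measurable_fun setT (g n)) ->
  measurable_fun setT (fun z : nat * T => g z.1 z.2).
Proof.
move=> mg _ A mA; rewrite setTI.
have -> : (fun z : nat * T => g z.1 z.2) @^-1` A =
    \bigcup_n ([set n] `*` (g n @^-1` A)).
  apply/seteqP; split=> -[n t] /=; first by move=> h; exists n.
  by move=> [k _ /= [->]].
apply: bigcupT_measurable => n; apply: measurableX => //.
by rewrite -[X in measurable X]setTI; exact: mg.
Qed.

Lemma markov_ge0 d (O : measurableType d) (R : realType) (P : probability O R)
    (A : set O) (a : R) (g : O -> \bar R) : measurable A ->
  measurable_fun setT g -> (forall w, 0 <= g w)%E -> (0 <= a) ->
  (forall w, A w -> a%:E <= g w)%E -> (a%:E * P A <= \int[P]_w g w)%E.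
Proof.
move=> mA mg g0 a0 Ag; rewrite -integral_cst//.
apply: (@le_trans _ _ (\int[P]_(w in A) g w)%E).
  by apply: ge0_le_integral => //; exact: measurable_funTS.
by apply: ge0_subset_integral.
Qed.

Section records.
Context dT (T : measurableType dT) (R : realType) (mu : probability T R).
Variables (xi : T -> nat) (v : nat -> T -> R).
Hypothesis mxi : measurable_fun setT xi.
Hypothesis mv : forall r, measurable_fun setT (v r).

Local Notation state := (nat * R * nat)%type.

(** The state is (counter, sum of the rewards, number of records). *)
Definition step (f : R -> R) (s : state) (l : T) : state :=
  if (s.1.1 < xi l)%N then (0%N, s.1.2 + f (v s.1.1 l), s.2.+1)
  else ((s.1.1.+1 - xi l)%N, s.1.2, s.2).

Definition state0 : state := (0%N, 0, 0%N).

Lemma measurable_step f : measurable_fun setT f ->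
  measurable_fun setT (fun z : state * T => step f z.1 z.2).
Proof.
move=> mf.
have m11 : measurable_fun setT (fun z : state * T => z.1.1).
  exact: (measurableT_comp measurable_fst measurable_fst).
have m111 : measurable_fun setT (fun z : state * T => z.1.1.1).
  exact: (measurableT_comp measurable_fst m11).
have m112 : measurable_fun setT (fun z : state * T => z.1.1.2).
  exact: (measurableT_comp measurable_snd m11).
have m12 : measurable_fun setT (fun z : state * T => z.1.2).
  exact: (measurableT_comp measurable_snd measurable_fst).
have mr : measurable_fun setT (fun z : state * T => (z.1.1.1, z.2)).
  exact: measurable_fun_pair.
rewrite /step; apply: measurable_fun_ifT.
- have mg n : measurable_fun setT (fun l => n < xi l)%N.
    by apply: (@measurableT_comp _ _ _ _ _ _ (fun k => n < k)%N).
  exact: (measurableT_comp (measurable_nat_pair mg) mr).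
- apply: measurable_fun_pair; last first.
    exact: (@measurableT_comp _ _ _ _ _ _ (fun k => k.+1)).
  apply: measurable_fun_pair => //; apply: measurable_funD => //.
  have mg n : measurable_fun setT (fun l => f (v n l)) by exact: measurableT_comp.
  exact: (measurableT_comp (measurable_nat_pair mg) mr).
- apply: measurable_fun_pair => //; apply: measurable_fun_pair => //.
  have mg n : measurable_fun setT (fun l => n.+1 - xi l)%N.
    by apply: (@measurableT_comp _ _ _ _ _ _ (fun k => n.+1 - k)%N).
  exact: (measurableT_comp (measurable_nat_pair mg) mr).
Qed.

(** The potential [h] compensates the reward of the next record.  Each record adds
at most [1] to the conditional mean of the square, which the decrease of
[K - c] pays for; the constant [1] keeps the weight nonnegative since
[|h| <= 1].  Past [K] records the weight is [0], which can only help a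
supermartingale. *)
Definition quad_weight (h : nat -> R) (K : nat) (s : state) : \bar R :=
  if (s.2 <= K)%N then (s.1.2 ^+ 2 + 2 * s.1.2 * h s.1.1 + (K - s.2)%:R + 1)%:E
  else 0%E.

(** First-order analogue of [quad_weight] for nonnegative rewards, where [D]
bounds the mean reward of one record. *)
Definition lin_weight (h : nat -> \bar R) (D : R) (K : nat) (s : state) : \bar R :=
  if (s.2 <= K)%N then (`|s.1.2| + (K - s.2)%:R * D)%:E + h s.1.1
  else 0%E.

Let ms11 : measurable_fun setT (fun s : state => s.1.1).
Proof. exact: (measurableT_comp measurable_fst measurable_fst). Qed.
Let ms12 : measurable_fun setT (fun s : state => s.1.2).
Proof. exact: (measurableT_comp measurable_snd measurable_fst). Qed.
Let ms2 : measurable_fun setT (fun s : state => s.2).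
Proof. exact: measurable_snd. Qed.
Let ms2_comp dU (U : measurableType dU) (g : nat -> U) :
  measurable_fun setT (fun s : state => g s.2).
Proof. exact: (@measurableT_comp _ _ _ _ _ _ g). Qed.
Let ms11_comp dU (U : measurableType dU) (g : nat -> U) :
  measurable_fun setT (fun s : state => g s.1.1).
Proof. exact: (@measurableT_comp _ _ _ _ _ _ g). Qed.

Lemma measurable_quad_weight h K : measurable_fun setT (quad_weight h K).
Proof.
apply: measurable_fun_ifT => //; first exact: (ms2_comp (fun c => c <= K)%N).
apply/measurable_EFinP; apply: measurable_funD => //.
apply: measurable_funD; last exact: (ms2_comp (fun c => (K - c)%:R : R)).
apply: measurable_funD; first exact: measurable_funX.
by apply: measurable_funM; [exact: measurable_funM|exact: ms11_comp].
Qed.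

Lemma measurable_lin_weight h D K : measurable_fun setT (lin_weight h D K).
Proof.
apply: measurable_fun_ifT => //; first exact: (ms2_comp (fun c => c <= K)%N).
apply: emeasurable_funD; last exact: ms11_comp.
apply/measurable_EFinP; apply: measurable_funD; first exact: measurableT_comp.
exact: (ms2_comp (fun c => (K - c)%:R * D : R)).
Qed.

Lemma quad_weight_ge0 h K s : (forall r, `|h r| <= 1) -> (0 <= quad_weight h K s)%E.
Proof.
move=> h1; rewrite /quad_weight; case: ifP => // _; rewrite lee_fin.
have hh : h s.1.1 ^+ 2 <= 1 by rewrite -real_normK ?num_real// expr_le1.
have k0 : 0 <= (K - s.2)%:R :> R by [].
have := sqr_ge0 (s.1.2 + h s.1.1); lra.
Qed.

Lemma lin_weight_ge0 h D K s : (forall r, 0 <= h r)%E -> 0 <= D ->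
  (0 <= lin_weight h D K s)%E.
Proof.
move=> h0 D0; rewrite /lin_weight; case: ifP => // _.
by rewrite adde_ge0// lee_fin addr_ge0// mulr_ge0.
Qed.

Lemma quad_weight_super (a : R -> R) (h : nat -> R) K s :
  measurable_fun setT a -> (forall y, `|a y| <= 1) ->
  (forall r, `|h r| <= 1) -> h 0%N = 0 ->
  (forall r, \int[mu]_l (if (r < xi l)%N then a (v r l) else h (r.+1 - xi l)%N)%:E
     = (h r)%:E)%E ->
  (\int[mu]_l quad_weight h K (step a s l) <= quad_weight h K s)%E.
Proof.
move=> ma a1 h1 h0 hE; case: s => [[r x] c].
have [cK|Kc] := leqP c K; last first.
  rewrite [leRHS]/quad_weight /= leqNgt Kc /= integral0_eq// => l _.
  rewrite /quad_weight /step /=; case: (r < xi l)%N => /=; last by rewrite leqNgt Kc.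
  by rewrite ltnNge (ltnW Kc).
pose j l := if (r < xi l)%N then a (v r l) else h (r.+1 - xi l)%N.
have j1 l : `|j l| <= 1 by rewrite /j; case: ifP.
have mj : measurable_fun setT j.
  apply: measurable_fun_ifT.
  - by apply: (@measurableT_comp _ _ _ _ _ _ (fun k => r < k)%N).
  - exact: measurableT_comp.
  - by apply: (@measurableT_comp _ _ _ _ _ _ (fun k => h (r.+1 - k)%N)).
have ij : mu.-integrable setT (EFin \o j).
  apply: measurable_bounded_integrable => //.
    by rewrite (le_lt_trans (probability_le1 _ _)) ?ltry.
  by exists 1; split=> // M M1 l _ /=; rewrite (le_trans (j1 l))// ltW.
pose A : R := x ^+ 2 + (K - c)%:R + 1.
have mstep : measurable_fun setT (step a (r, x, c)).
  exact: (measurable_fun_pair2 (r, x, c) (measurable_step ma)).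
apply: (@le_trans _ _ (\int[mu]_l (A%:E + (2 * x)%:E * (j l)%:E))%E).
  apply: ge0_le_integral => //.
  - by move=> l _; exact: quad_weight_ge0.
  - exact: (measurableT_comp (measurable_quad_weight h K)).
  - apply: emeasurable_funD => //; apply: emeasurable_funM => //.
    exact/measurable_EFinP.
  move=> l _; rewrite -EFinM -EFinD /A /j /quad_weight /step /=.
  have k0 : 0 <= (K - c)%:R :> R by [].
  case: (r < xi l)%N => /=; last by rewrite cK lee_fin; lra.
  have aa : a (v r l) ^+ 2 <= 1.
    by rewrite -real_normK ?num_real// expr_le1.
  case: ifP => [cK'|_]; last first.
    by rewrite lee_fin; have := sqr_ge0 (x + a (v r l)); lra.
  rewrite h0 lee_fin.
  have -> : (K - c)%:R = (K - c.+1)%:R + 1 :> R by rewrite natr1 subnSK.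
  lra.
rewrite integralD//; last 2 first.
- exact: finite_measure_integrable_cst.
- exact: integrableZl.
rewrite integral_cst//= probability_setT mule1 integralZl// hE.
rewrite /quad_weight /= cK -EFinM -EFinD lee_fin /A; lra.
Qed.

Lemma lin_weight_super (b : R -> R) D K s :
  measurable_fun setT b -> (forall y, 0 <= b y) -> 0 <= D ->
  let c := (fun r l => (b (v r l))%:E) in
  (potential mu xi c 0 <= D%:E)%E ->
  (\int[mu]_l lin_weight (potential mu xi c) D K (step b s l)
     <= lin_weight (potential mu xi c) D K s)%E.
Proof.
move=> mb b0 D0 ch hD; case: s => [[r x] c].
have rc : reward ch.
  split=> [k|k l]; last by rewrite lee_fin.
  by apply/measurable_EFinP; exact: measurableT_comp.
have p0 k : (0 <= potential mu xi ch k)%E by exact: potential_ge0.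
have [cK|Kc] := leqP c K; last first.
  rewrite [leRHS]/lin_weight /= leqNgt Kc /= integral0_eq// => l _.
  rewrite /lin_weight /step /=; case: (r < xi l)%N => /=; last by rewrite leqNgt Kc.
  by rewrite ltnNge (ltnW Kc).
have mstep : measurable_fun setT (step b (r, x, c)).
  exact: (measurable_fun_pair2 (r, x, c) (measurable_step mb)).
pose A : R := `|x| + (K - c)%:R * D.
have A0 : 0 <= A by rewrite addr_ge0// mulr_ge0.
pose g := potential mu xi ch.
have mj : measurable_fun setT (jump xi ch g r) by apply: measurable_jump => //; case: rc.
have j0 l : (0 <= jump xi ch g r l)%E by exact: jump_ge0.
apply: (@le_trans _ _ (\int[mu]_l (A%:E + jump xi ch g r l))%E).
  apply: ge0_le_integral => //.
  - by move=> l _; exact: lin_weight_ge0.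
  - exact: (measurableT_comp (measurable_lin_weight g D K)).
  - exact: emeasurable_funD.
  move=> l _; rewrite /jump /lin_weight /step /=.
  case: (r < xi l)%N => /=; last by rewrite cK.
  case: ifP => [cK'|_]; last by rewrite adde_ge0// lee_fin.
  apply: (@le_trans _ _ ((`|x + b (v r l)| + (K - c.+1)%:R * D)%:E + D%:E)%E).
    exact: leeD.
  rewrite -!EFinD lee_fin /A.
  have -> : (K - c)%:R = (K - c.+1)%:R + 1 :> R by rewrite natr1 subnSK.
  have : `|x + b (v r l)| <= `|x| + b (v r l).
    by rewrite (le_trans (ler_normD _ _))// lerD2l ger0_norm.
  lra.
rewrite ge0_integralD//.
rewrite integral_cst//= probability_setT mule1 -potentialE//.
by rewrite /lin_weight /= cK.
Qed.

End records.

(** * Deviation of the sum of the record values *)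

Section record_deviation.
Context dT (T : measurableType dT) dO (O : measurableType dO)
  (R : realType) (I : choiceType).
Variables (P : probability O R) (mu : probability T R) (W : I -> {mfun O >-> T}).
Hypothesis indepW : forall (s : seq I) (A : I -> set T), uniq s ->
  (forall n, measurable (A n)) ->
  P (\bigcap_(n in [set` s]) (W n @^-1` A n)) = (\prod_(n <- s) mu (A n))%E.
Variables (xi : T -> nat) (v : nat -> T -> R).
Hypothesis mxi : measurable_fun setT xi.
Hypothesis mv : forall r, measurable_fun setT (v r).
Hypothesis mean_xi : (\int[mu]_l (xi l)%:R%:E <= 1)%E.

Definition chain (f : R -> R) (js : seq I) (w : O) : nat * R * nat :=
  run W (step xi v f) (state0 R) js w.

Lemma measurable_chain f js : measurable_fun setT f ->
  measurable_fun setT (chain f js).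
Proof. by move=> mf; apply: measurable_run; exact: measurable_step. Qed.

Lemma measurable_chain_deviation f js (g : O -> R) K (lam : R) :
  measurable_fun setT f -> measurable_fun setT g ->
  measurable [set w | ((chain f js w).2 <= K)%N /\ lam < `|g w|].
Proof.
move=> mf mg; have mc := measurable_chain js mf.
have m1 : measurable_fun setT (fun w => (chain f js w).2 <= K)%N.
  apply: (@measurableT_comp _ _ _ _ _ _ (fun c => c <= K)%N) => //.
  exact: (measurableT_comp measurable_snd mc).
have -> : [set w | ((chain f js w).2 <= K)%N /\ lam < `|g w|] =
    (fun w => (chain f js w).2 <= K)%N @^-1` [set true] `&`
    (fun w => `|g w|) @^-1` `]lam, +oo[.
  by apply/seteqP; split=> w /= [h1 h2]; split=> //=; move: h2; rewrite in_itv/= andbT.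
apply: measurableI; rewrite -[X in measurable X]setTI; first exact: m1.
by apply: (measurableT_comp (@normr_measurable R setT) mg).
Qed.

(** Chebyshev inequality from the supermartingale [quad_weight]. *)
Lemma centered_deviation (b : R -> R) (e : R) js K (lam : R) : uniq js ->
  measurable_fun setT b -> (forall y, 0 <= b y <= 1) -> 0 <= e <= 1 -> 0 < lam ->
  (total_reward mu xi (fun r l => (b (v r l))%:E) <= \int[mu]_l (xi l)%:R%:E * e%:E)%E ->
  (total_reward mu xi (fun r l => (1 - b (v r l))%:E)
     <= \int[mu]_l (xi l)%:R%:E * (1 - e)%:E)%E ->
  (P [set w | ((chain (fun y => b y - e)%R js w).2 <= K)%N /\
              (lam < `|(chain (fun y => b y - e)%R js w).1.2|)%R]
    <= (2 * K.+2%:R / lam ^+ 2)%:E)%E.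
Proof.
move=> ujs mb b01 e01 lam0 tb tb'.
have mbv r : measurable_fun setT (fun l => b (v r l)) by exact: measurableT_comp.
have [h [h1 h0 hE]] := centered_potential mxi mbv
  (fun r l => b01 (v r l)) e01 mean_xi tb tb'.
pose a y := b y - e.
have ma : measurable_fun setT a by exact: measurable_funB.
have a1 y : `|a y| <= 1.
  have /andP[b0 b1] := b01 y; have /andP[e0 e1] := e01.
  by rewrite /a ler_norml; apply/andP; split; lra.
have mq := measurable_quad_weight h K.
have q0 := fun s => quad_weight_ge0 K s h1.
have EV : (\int[P]_w quad_weight h K (chain a js w) <= (K.+1%:R)%:E)%E.
  have -> : (K.+1%:R)%:E = quad_weight h K (state0 R).
    by rewrite /quad_weight /= expr0n/= mulr0 mul0r !add0r subn0 natr1.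
  apply: (supermartingale_run indepW) => //; first exact: measurable_step.
  by move=> s; exact: quad_weight_super.
have mx : measurable_fun setT (fun w => (chain a js w).1.2).
  apply: (measurableT_comp measurable_snd).
  exact: (measurableT_comp measurable_fst (measurable_chain js ma)).
have mA := measurable_chain_deviation js K lam ma mx.
have mg : measurable_fun setT (fun w => quad_weight h K (chain a js w)).
  exact: (measurableT_comp mq (measurable_chain js ma)).
have lam2 : 0 < lam ^+ 2 by rewrite exprn_gt0.
have : ((lam ^+ 2 / 2)%:E * P [set w | ((chain a js w).2 <= K)%N /\
      (lam < `|(chain a js w).1.2|)%R]
    <= \int[P]_w (quad_weight h K (chain a js w) + 1))%E.
  apply: markov_ge0 => //.
  - exact: emeasurable_funD.
  - by move=> w; rewrite adde_ge0.
  - by rewrite divr_ge0// ltW.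
  move=> w [cK xl]; rewrite /quad_weight cK -EFinD lee_fin.
  set x := (chain a js w).1.2 in xl *.
  have xx : lam ^+ 2 <= x ^+ 2.
    by rewrite -[leRHS]real_normK ?num_real// lerXn2r ?nnegrE ?(ltW lam0)// ltW.
  have hh : h (chain a js w).1.1 ^+ 2 <= 1 by rewrite -real_normK ?num_real// expr_le1.
  have k0 : 0 <= (K - (chain a js w).2)%:R :> R by [].
  have := sqr_ge0 (x + 2 * h (chain a js w).1.1); lra.
rewrite ge0_integralD// integral_cst1 => hP.
have {}hP := le_trans hP (leeD EV (lexx 1%E)).
have Pfin : P [set w | ((chain a js w).2 <= K)%N /\ (lam < `|(chain a js w).1.2|)%R]
  \is a fin_num by exact: fin_num_measure.
rewrite -(fineK Pfin) -EFinM -EFinD lee_fin natr1 in hP.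
rewrite -(fineK Pfin) lee_fin ler_pdivlMr//; lra.
Qed.

(** Markov inequality from the supermartingale [lin_weight]. *)
Lemma nonneg_deviation (b : R -> R) (D : R) js K (lam : R) : uniq js ->
  measurable_fun setT b -> (forall y, 0 <= b y) -> 0 < lam -> 0 <= D ->
  (total_reward mu xi (fun r l => (b (v r l))%:E) <= D%:E)%E ->
  (P [set w | ((chain b js w).2 <= K)%N /\ (lam < `|(chain b js w).1.2|)%R]
    <= (K.+1%:R * D / lam)%:E)%E.
Proof.
move=> ujs mb b0 lam0 D0 tb.
pose c r l := (b (v r l))%:E : \bar R.
have rc : reward c.
  split=> [k|k l]; last by rewrite lee_fin.
  by apply/measurable_EFinP; exact: measurableT_comp.
have pD : (potential mu xi c 0 <= D%:E)%E.
  by apply: potential_ub => // n; apply: le_trans tb; exact: first_reward_le_total.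
pose g := potential mu xi c.
have g0 r : (0 <= g r)%E by exact: potential_ge0.
have mq := measurable_lin_weight g D K.
have q0 := fun s => lin_weight_ge0 K s g0 D0.
have EV : (\int[P]_w lin_weight g D K (chain b js w) <= (K.+1%:R * D)%:E)%E.
  apply: (@le_trans _ _ (lin_weight g D K (state0 R))).
    apply: (supermartingale_run indepW) => //; first exact: measurable_step.
    by move=> s; exact: lin_weight_super.
  rewrite /lin_weight /= normr0 add0r subn0 -natr1 mulrDl mul1r EFinD.
  by rewrite leeD2l.
have mx : measurable_fun setT (fun w => (chain b js w).1.2).
  apply: (measurableT_comp measurable_snd).
  exact: (measurableT_comp measurable_fst (measurable_chain js mb)).
have mA := measurable_chain_deviation js K lam mb mx.
have mg : measurable_fun setT (fun w => lin_weight g D K (chain b js w)).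
  exact: (measurableT_comp mq (measurable_chain js mb)).
have : (lam%:E * P [set w | ((chain b js w).2 <= K)%N /\
      (lam < `|(chain b js w).1.2|)%R]
    <= \int[P]_w (lin_weight g D K (chain b js w)))%E.
  apply: markov_ge0 => //; first exact: ltW.
  move=> w [cK xl]; rewrite /lin_weight cK EFinD -addeA.
  apply: (@le_trans _ _ (`|(chain b js w).1.2|%:E)); first by rewrite lee_fin ltW.
  by rewrite leeDl// adde_ge0// lee_fin mulr_ge0.
move=> hP; have {}hP := le_trans hP EV.
have Pfin : P [set w | ((chain b js w).2 <= K)%N /\ (lam < `|(chain b js w).1.2|)%R]
  \is a fin_num by exact: fin_num_measure.
rewrite -(fineK Pfin) -EFinM lee_fin in hP.
rewrite -(fineK Pfin) lee_fin ler_pdivlMr//; lra.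
Qed.

(** Three chains driven by the same inputs share their counters, so a reward that
is affine in another one up to an error propagates to the sums. *)
Lemma chain_split (f a b : R -> R) (s k : R) js w :
  (forall y, `|f y - (s * a y + k)| <= b y) ->
  [/\ (chain f js w).2 = (chain a js w).2, (chain f js w).2 = (chain b js w).2 &
   `|(chain f js w).1.2 - (s * (chain a js w).1.2 + k * (chain f js w).2%:R)|
     <= (chain b js w).1.2].
Proof.
move=> H; suff : [/\ (chain f js w).1.1 = (chain a js w).1.1,
    (chain f js w).1.1 = (chain b js w).1.1,
    (chain f js w).2 = (chain a js w).2,
    (chain f js w).2 = (chain b js w).2 &
   `|(chain f js w).1.2 - (s * (chain a js w).1.2 + k * (chain f js w).2%:R)|
     <= (chain b js w).1.2] by case.
elim/last_ind: js => [|js j [ra rb ca cb IH]].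
  by rewrite /chain /run /=; split=> //; rewrite !mulr0 addr0 subr0 normr0.
rewrite /chain !run_rcons /step -!/(chain _ js w) -ra -rb -ca -cb.
case: ifP => _ /=; split=> //.
apply: le_trans (lerD IH (H (v (chain f js w).1.1 (W j w)))).
apply: le_trans (ler_normD _ _); rewrite le_eqVlt; apply/orP; left.
by rewrite -natr1; apply/eqP; congr (`| _ |); ring.
Qed.

End record_deviation.

(** * Measurability of the atoms of a point measure *)

Section atoms_measurable.
Context {R : realType}.
Implicit Types nu : pointm R.

Lemma open_weak_subbase (f : R -> R) (U : set R) : weak_test f -> open U ->
  open (weak_subbase (f, U) : set (pointm R)).
Proof.
move=> tf oU; exists [set weak_subbase (f, U)]; last by rewrite bigcup_set1.
move=> _ ->; exact: (finI_from1 (@weak_subbase R) (i := (f, U))).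
Qed.

Lemma atoms_gt0 nu i : (i < pm_mass nu)%N -> 0 < nth 0 nu i.
Proof. by move=> h; have /andP[_ /allP] := atomsP nu; apply; exact: mem_nth. Qed.

Lemma nth_atoms_ge0 nu i : 0 <= nth 0 nu i.
Proof.
have [h|h] := ltnP i (pm_mass nu); first exact/ltW/atoms_gt0.
by rewrite nth_default.
Qed.

Lemma nth_atoms_anti nu i j : (i <= j)%N -> nth 0 nu j <= nth 0 nu i.
Proof.
move=> ij; have [jn|jn] := ltnP j (size nu); last first.
  by rewrite [X in X <= _]nth_default// nth_atoms_ge0.
have /andP[snu _] := atomsP nu.
apply: (sorted_leq_nth _ _ 0 snu) => //.
- by move=> x y z xy yz; exact: le_trans yz xy.
- by move=> x; exact: lexx.
- by rewrite inE (leq_ltn_trans ij jn).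
Qed.

(** This turns the residual maximum into an order statistic, which is what can
be tested with integrals. *)
Lemma pm_sup_upsilon r nu : pm_sup (upsilon r nu) = nth 0 nu r.
Proof.
rewrite /pm_sup /=; have [h|h] := ltnP r (size nu); last first.
  rewrite nth_default// drop_oversize// (_ : [set _ | _] = set0) ?sup0//.
  by apply/seteqP; split.
have memP x : (x \in drop r nu) -> x <= nth 0 nu r.
  move=> /(nthP 0)[i]; rewrite size_drop => _ <-.
  by rewrite nth_drop nth_atoms_anti// leq_addr.
have r_in : nth 0 nu r \in drop r nu by rewrite (drop_nth 0)// mem_head.
apply/eqP; rewrite eq_le; apply/andP; split.
  by apply: ge_sup; [exists (nth 0 nu r)|move=> x; exact: memP].
apply: ub_le_sup => //; exists (nth 0 nu r) => x; exact: memP.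
Qed.

Lemma integral_pm_measure nu (f : R -> R) : measurable_fun setT f ->
  (forall x, 0 <= f x) ->
  (\int[pm_measure nu]_(x in `]0, +oo[) f x)%R = \sum_(i < pm_mass nu) f (nth 0 nu i).
Proof.
move=> mf f0; rewrite /Rintegral /pm_measure.
have mf' : measurable_fun (`]0, +oo[%classic : set R) (EFin \o f).
  by apply/measurable_EFinP; exact: measurable_funTS.
rewrite ge0_integral_measure_sum//; last by move=> x _; rewrite lee_fin.
rewrite (eq_bigr (fun i : 'I_(size nu) => (f (nth 0 nu i))%:E)).
  by rewrite sumEFin.
move=> i _; rewrite integral_dirac// diracE mem_set ?mul1e//=.
by rewrite in_itv/= andbT atoms_gt0.
Qed.

(** Continuous approximations from below of the indicator of [(x, +oo)]. *)
Definition ramp (x : R) (m : nat) (y : R) : R := Num.min 1 (m%:R * Num.max 0 (y - x)).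

Lemma continuous_ramp x m : continuous (ramp x m).
Proof.
move=> y; apply: (@continuous_min R R (fun=> 1) _ y); first exact: cst_continuous.
apply: (@continuousM R R (fun=> m%:R) _ y); first exact: cst_continuous.
apply: (@continuous_max R R (fun=> 0) _ y); first exact: cst_continuous.
by apply: continuousB; [exact: cvg_id|exact: cst_continuous].
Qed.

Lemma ramp_ge0 x m y : 0 <= ramp x m y.
Proof. by rewrite /ramp le_min ler01 mulr_ge0// le_max lexx. Qed.

Lemma ramp_le1 x m y : ramp x m y <= 1.
Proof. by rewrite /ramp ge_min lexx. Qed.

Lemma weak_test_ramp x m : weak_test (ramp x m).
Proof.
split; first exact/continuous_subspaceT/continuous_ramp.
by exists 1 => y _; rewrite ger0_norm ?ramp_ge0// ramp_le1.
Qed.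

(** The [r]-th atom (counting from [0]) exceeds [x] when more than [r] units of
mass lie beyond [x]; a steep enough ramp detects this, and a ramp never
overestimates the mass. *)
Lemma nth_atoms_gt x r nu : 0 <= x ->
  x < nth 0 nu r <->
  exists m, r%:R < (\int[pm_measure nu]_(y in `]0, +oo[) ramp x m y)%R.
Proof.
move=> x0; have iE m : (\int[pm_measure nu]_(y in `]0, +oo[) ramp x m y)%R =
    \sum_(i < pm_mass nu) ramp x m (nth 0 nu i).
  apply: integral_pm_measure => [|y]; last exact: ramp_ge0.
  by apply: continuous_measurable_fun => y; exact: continuous_ramp.
split=> [xr|[m]].
  have rn : (r < pm_mass nu)%N.
    rewrite ltnNge; apply/negP => h; move: xr.
    by rewrite nth_default// ltNge x0.
  have d0 : 0 < nth 0 nu r - x by rewrite subr_gt0.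
  (* steep enough for the ramp to have reached 1 at the [r]-th atom *)
  exists (Num.truncn (nth 0 nu r - x)^-1).+1; rewrite iE.
  rewrite -(subnKC rn) big_split_ord /=.
  apply: (@lt_le_trans _ _ r.+1%:R); first by rewrite ltr_nat.
  rewrite -[leLHS]addr0; apply: lerD; last by apply: sumr_ge0 => i _; exact: ramp_ge0.
  have -> : r.+1%:R = \sum_(i < r.+1) 1 :> R by rewrite sumr_const card_ord.
  apply: ler_sum => i _; rewrite /ramp le_min lexx/=.
  have d_le : nth 0 nu r - x <= Num.max 0 (nth 0 nu i - x).
    by rewrite le_max; apply/orP; right; rewrite lerD2r nth_atoms_anti// -ltnS.
  apply: (@le_trans _ _ ((Num.truncn (nth 0 nu r - x)^-1).+1%:R * (nth 0 nu r - x))).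
    rewrite -ler_pdivrMr// mul1r; apply/ltW; exact: truncnS_gt.
  by rewrite ler_wpM2l.
rewrite iE; apply: contraTT; rewrite -!leNgt => xr.
rewrite -(big_mkord xpredT (fun i => ramp x m (nth 0 nu i))).
have z i : (r <= i)%N -> ramp x m (nth 0 nu i) = 0.
  move=> ri; have : nth 0 nu i <= x by exact: le_trans (nth_atoms_anti nu ri) xr.
  rewrite -subr_le0 => /max_idPl h.
  by rewrite /ramp h mulr0 min_r.
have [nr|rn] := leqP (pm_mass nu) r.
  rewrite (@le_trans _ _ (\sum_(0 <= i < pm_mass nu) 1))//.
    by apply: ler_sum => i _; exact: ramp_le1.
  by rewrite sumr_const_nat subn0 ler_nat.
rewrite (big_cat_nat (n := r))//=; last exact: ltnW.
rewrite [X in _ + X]big_nat [X in _ + X]big1 ?addr0; last by move=> i /andP[/z].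
rewrite (@le_trans _ _ (\sum_(0 <= i < r) 1))//.
  by apply: ler_sum => i _; exact: ramp_le1.
by rewrite sumr_const_nat subn0.
Qed.

Lemma measurable_nth_atoms r :
  measurable_fun setT (fun nu : pointm R => nth 0 nu r).
Proof.
move=> _; apply: (measurability _ (RGenOInfty.measurableE R)) => //.
move=> /= _ [_ [x ->] <-]; rewrite setTI preimage_itvoy.
have [x0|x0] := leP 0 x; last first.
  rewrite (_ : [set _ | _] = setT)//; apply/seteqP; split=> // nu _ /=.
  exact: lt_le_trans (nth_atoms_ge0 _ _).
rewrite (_ : [set _ | _] = \bigcup_m weak_subbase (ramp x m, [set y | r%:R < y])).
  apply: bigcupT_measurable => m; apply: sub_sigma_algebra.
  by apply: open_weak_subbase; [exact: weak_test_ramp|exact: open_gt].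
apply/seteqP; split=> nu /= => [/(nth_atoms_gt _ _ x0)[m h]|[m _ h]].
  by exists m.
by apply/nth_atoms_gt => //; exists m.
Qed.

Lemma measurable_progeny : measurable_fun setT (@progeny R).
Proof.
move=> _ A mA; rewrite setTI; exists (setT `*` A); first exact: measurableX.
by rewrite setTI; apply/seteqP; split=> l //= [].
Qed.

Lemma pm_mass_gt r nu : (r < pm_mass nu)%N = (0 < nth 0 nu r).
Proof.
apply/idP/idP; first exact: atoms_gt0.
by apply: contraTT; rewrite -leqNgt -leNgt => h; rewrite nth_default.
Qed.

Definition brood (l : life R) : nat := pm_mass (progeny l).
(** Age of the individual at the birth of the next child on the spine, when the
subtrees of its [r] last-born children are completed. *)
Definition residual (r : nat) (l : life R) : R := pm_sup (upsilon r (progeny l)).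

Lemma measurable_residual r : measurable_fun setT (residual r).
Proof.
rewrite (_ : residual r = (fun nu : pointm R => nth 0 nu r) \o @progeny R).
  exact: measurableT_comp (measurable_nth_atoms r) measurable_progeny.
by apply/funext => l; exact: pm_sup_upsilon.
Qed.

Lemma measurable_brood : measurable_fun setT brood.
Proof.
(* having more than [r] children means that the [r]-th atom is positive *)
have gt r : measurable [set l | (r < brood l)%N].
  rewrite (_ : [set _ | _] = residual r @^-1` `]0, +oo[).
    rewrite -[X in measurable X]setTI; exact: measurable_residual.
  apply/seteqP; split=> l /=; rewrite in_itv/= andbT /residual pm_sup_upsilon;
    by rewrite /brood pm_mass_gt.
move=> _ A _; rewrite setTI.
have -> : brood @^-1` A = \bigcup_(k in A) [set l | brood l = k].
  by apply/seteqP; split=> l /=; [move=> h; exists (brood l)|move=> [k Ak /= ->]].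
apply: bigcup_measurable => k _.
have -> : [set l | brood l = k] = [set l | (k <= brood l)%N] `\` [set l | (k < brood l)%N].
  apply/seteqP; split=> l /=; first by move=> ->; rewrite ltnn.
  by move=> [h /negP]; rewrite -leqNgt => h'; apply/eqP; rewrite eqn_leq h h'.
apply: measurableD => //; case: k => [|k]; last exact: gt.
by rewrite (_ : [set _ | _] = setT)//; apply/seteqP; split.
Qed.

End atoms_measurable.

(** * The law of a record value *)

Section law_of_record.
Context dX (TX : measurableType dX) dY (TY : measurableType dY) (R : realType).
Variables (QX : probability TX R) (X : {mfun TX >-> life R}).
Variables (QY : probability TY R) (Y : {RV QY >-> R}).
Hypothesis offspring01 :
  (0 < 'E_QX[fun w => (pm_mass (progeny (X w)))%:R] <= 1)%E.
Hypothesis lawY : has_law_Ystar QX X Y.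

Definition life_law := distribution QX X.

Let mu : probability (life R) R := life_law.

Lemma mean_broodE :
  ('E_QX[fun w => (pm_mass (progeny (X w)))%:R] = \int[mu]_l (brood l)%:R%:E)%E.
Proof.
rewrite unlock ge0_integral_distribution//.
exact: (measurable_comp_xi (@measurable_brood R) (fun k => k%:R%:E : \bar R)).
Qed.

Lemma mean_brood_le1 : (\int[mu]_l (brood l)%:R%:E <= 1)%E.
Proof. by rewrite -mean_broodE; case/andP: offspring01. Qed.

Let mean_gt0 : (0 < \int[mu]_l (brood l)%:R%:E)%E.
Proof. by rewrite -mean_broodE; case/andP: offspring01. Qed.

Let mean_fin : (\int[mu]_l (brood l)%:R%:E)%E \is a fin_num.
Proof.
by rewrite ge0_fin_numE ?ltW//; exact: le_lt_trans mean_brood_le1 (ltry _).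
Qed.

Let measurable_brood_eq k : measurable [set l : life R | brood l = k].
Proof.
rewrite -[X in measurable X]setTI; exact: (@measurable_brood R measurableT [set k]).
Qed.

Let mf_residual (f : R -> R) r D : measurable_fun setT f -> measurable D ->
  measurable_fun D (fun l => (f (residual r l))%:E).
Proof.
move=> mf mD; apply/measurable_EFinP; apply: measurable_funTS.
exact: (measurableT_comp mf (measurable_residual r)).
Qed.

Lemma reward_residual (f : R -> R) : measurable_fun setT f -> (forall x, 0 <= f x) ->
  reward (fun r (l : life R) => (f (residual r l))%:E).
Proof.
move=> mf f0; split=> [r|r l]; last by rewrite lee_fin.
exact: mf_residual.
Qed.

(** The weights [1 / k] and [k P(|P| = k)] of the law of [Ystar] cancel, which leaves
the mean over the offspring measure of the sum of [f] over all residuals. *)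
Lemma total_reward_bounded (f : R -> R) : measurable_fun setT f ->
  (forall x, 0 <= f x) -> (exists M, forall x, f x <= M) ->
  (total_reward mu brood (fun r l => (f (residual r l))%:E) =
   \int[mu]_l (brood l)%:R%:E * 'E_QY[f \o Y])%E.
Proof.
move=> mf f0 [M fM].
have rf := reward_residual mf f0.
have mu_fin A : measurable A -> mu A \is a fin_num by move=> mA; exact: fin_num_measure.
set B := fun k => [set l : life R | brood l = k].
have mB k : measurable (B k) by exact: measurable_brood_eq.
pose I k r := fine (\int[mu]_(l in B k) (f (residual r l))%:E)%E.
have Ifin k r : (\int[mu]_(l in B k) (f (residual r l))%:E)%E \is a fin_num.
  rewrite ge0_fin_numE; last by apply: integral_ge0 => l _; rewrite lee_fin.
  apply: (@le_lt_trans _ _ (\int[mu]_(l in B k) (cst M%:E) l)%E).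
    apply: ge0_le_integral => //.
    - by move=> l _; rewrite lee_fin.
    - exact: mf_residual.
    - by move=> l _; rewrite lee_fin.
  by rewrite integral_cst//= ltey_eq fin_numM// mu_fin.
have I0 k r : 0 <= I k r by apply/fine_ge0/integral_ge0 => l _; rewrite lee_fin.
have condE k r : cond_exp_event QX (fun w => f (pm_sup (upsilon r (progeny (X w)))))
     [set w | pm_mass (progeny (X w)) = k] = I k r / fine (mu (B k)).
  rewrite /cond_exp_event /I ge0_integral_pushforward//.
  - exact: mf_residual.
  - by move=> l _; rewrite lee_fin.
have I_null k r : fine (mu (B k)) = 0 -> I k r = 0.
  move=> h; have h0 : mu (B k) = 0%E by rewrite -(fineK (mu_fin _ (mB k))) h.
  by rewrite /I null_set_integral//; exact: mf_residual.
pose m := fine (\int[mu]_l (brood l)%:R%:E)%E.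
have m0 : 0 < m by rewrite fine_gt0// mean_gt0/= ltey_eq mean_fin.
have -> : ('E_QY[f \o Y] = \sum_(1 <= k <oo) (\sum_(0 <= r < k) I k r / m)%:E)%E.
  rewrite lawY//; last first.
    by exists M => x; rewrite ger0_norm.
  apply: congr_lim; apply/funext => n.
  rewrite big_nat [in RHS]big_nat; apply: eq_bigr => k /andP[k1 _].
  congr (_%:E); apply: eq_bigr => r _; rewrite condE mean_broodE -/m.
  (* on a null event the conditional mean is 0, and so is the integral *)
  have [h|h] := eqVneq (fine (mu (B k))) 0.
    by rewrite I_null// !mul0r !mulr0 !mul0r.
  rewrite -[fine (QX _)]/(fine (mu (B k))).
  have kn0 : k%:R != 0 :> R by rewrite pnatr_eq0 -lt0n.
  by field; rewrite h kn0 gt_eqF.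
have rI0 k : (0 <= (\sum_(0 <= r < k) I k r)%:E)%E by rewrite lee_fin sumr_ge0.
have -> : (\sum_(1 <= k <oo) (\sum_(0 <= r < k) I k r / m)%:E =
   (m^-1)%:E * \sum_(1 <= k <oo) (\sum_(0 <= r < k) I k r)%:E)%E.
  rewrite -nneseriesZl//; apply: eq_eseriesr => k _.
  by rewrite -mulr_suml mulrC EFinM.
rewrite muleA -[X in (X * _ * _)%E]fineK// -EFinM divff ?gt_eqF// mul1e.
transitivity (\sum_(0 <= k <oo) (\sum_(0 <= r < k) I k r)%:E)%E; last first.
  by rewrite nneseries_recl// big_nil add0e.
rewrite total_rewardE//; last exact: measurable_brood.
have trivB : trivIset setT B.
  by apply/trivIsetP => i j _ _ ij; apply/seteqP; split=> // l [/= hi hj]; move: ij; rewrite -hi -hj eqxx.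
have bigB : \bigcup_k B k = setT.
  by apply/seteqP; split=> // l _; exists (brood l).
have mS : measurable_fun setT
    (fun l : life R => \sum_(0 <= r < brood l) (f (residual r l))%:E)%E.
  apply: (@measurable_comp _ _ _ _ _ _ setT (fun z : nat * life R =>
    \sum_(0 <= r < z.1) (f (residual r z.2))%:E)%E _ (fun l => (brood l, l))) => //.
    apply: (measurable_nat_pair (g := fun k l =>
      \sum_(0 <= r < k) (f (residual r l))%:E)%E) => k.
    by apply: emeasurable_sum => r; exact: mf_residual.
  by apply: measurable_fun_pair => //; exact: measurable_brood.
have S0 (l : life R) : (0 <= \sum_(0 <= r < brood l) (f (residual r l))%:E)%E.
  by apply: sume_ge0 => r _; rewrite lee_fin.
rewrite -[in LHS]bigB ge0_integral_bigcup//; last by rewrite bigB.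
apply: eq_eseriesr => k _; rewrite -sumEFin.
transitivity (\int[mu]_(l in B k) \sum_(0 <= r < k) (f (residual r l))%:E)%E.
  by apply: eq_integral => l; rewrite inE => <-.
rewrite ge0_integral_sum//; last 2 first.
- by move=> r; exact: mf_residual.
- by move=> r l _; rewrite lee_fin.
by apply: eq_bigr => r _; rewrite /I fineK.
Qed.

(** Monotone convergence from [total_reward_bounded]. *)
Lemma total_reward_le (f : R -> R) : measurable_fun setT f ->
  (forall x, 0 <= f x) ->
  (total_reward mu brood (fun r l => (f (residual r l))%:E) <=
   \int[mu]_l (brood l)%:R%:E * 'E_QY[f \o Y])%E.
Proof.
move=> mf f0.
pose g (J : nat) x := Num.min (f x) J%:R.
have mg J : measurable_fun setT (g J) by exact: measurable_minr.
have g0 J x : 0 <= g J x by rewrite /g le_min f0/=.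
have gf J x : g J x <= f x by rewrite /g ge_min lexx.
have gnd x a b : (a <= b)%N -> g a x <= g b x.
  by move=> ab; rewrite /g le_min ge_min lexx/= ge_min ler_nat ab orbT.
rewrite total_rewardE; [|exact: measurable_brood|exact: reward_residual].
have mS (h : R -> R) : measurable_fun setT h -> measurable_fun setT
    (fun l : life R => \sum_(0 <= r < brood l) (h (residual r l))%:E)%E.
  move=> mh; apply: (@measurable_comp _ _ _ _ _ _ setT (fun z : nat * life R =>
    \sum_(0 <= r < z.1) (h (residual r z.2))%:E)%E _ (fun l => (brood l, l))) => //.
    apply: (measurable_nat_pair (g := fun k l =>
      \sum_(0 <= r < k) (h (residual r l))%:E)%E) => k.
    by apply: emeasurable_sum => r; exact: mf_residual.
  by apply: measurable_fun_pair => //; exact: measurable_brood.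
have S0 J (l : life R) : (0 <= \sum_(0 <= r < brood l) (g J (residual r l))%:E)%E.
  by apply: sume_ge0 => r _; rewrite lee_fin.
have Snd (l : life R) : nondecreasing_seq
    (fun J => \sum_(0 <= r < brood l) (g J (residual r l))%:E)%E.
  by move=> a b ab; apply: lee_sum => r _; rewrite lee_fin gnd.
rewrite (eq_integral (fun l => limn (fun J =>
    \sum_(0 <= r < brood l) (g J (residual r l))%:E)%E)); last first.
  move=> l _; apply/esym/lim_near_cst => //.
  exists (Num.truncn (\sum_(0 <= r < brood l) f (residual r l))).+1 => // J /= hJ.
  rewrite big_nat [RHS]big_nat; apply: eq_bigr => r /andP[_ rl]; congr (_%:E).
  apply/min_idPl; apply: (@le_trans _ _ (\sum_(0 <= r < brood l) f (residual r l))).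
    rewrite big_mkord (bigD1 (Ordinal rl))//= lerDl sumr_ge0//.
  apply/ltW/(lt_le_trans (truncnS_gt _)); by rewrite ler_nat.
rewrite monotone_convergence//; last by move=> J; exact: mS.
apply: lime_le.
  apply: ereal_nondecreasing_is_cvgn => a b ab; apply: ge0_le_integral => //.
  - exact: mS.
  - exact: mS.
  - by move=> l _; exact: Snd.
apply: nearW => J.
rewrite -total_rewardE; [|exact: measurable_brood|exact: reward_residual].
rewrite total_reward_bounded//; last by exists J%:R => x; rewrite /g ge_min lexx orbT.
apply: lee_wpmul2l; first exact: ltW mean_gt0.
rewrite unlock; apply: ge0_le_integral => //.
- by move=> w _; rewrite lee_fin; exact: g0.
- by apply/measurable_EFinP; exact: measurableT_comp.
- by apply/measurable_EFinP; exact: measurableT_comp.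
- by move=> w _; rewrite lee_fin; exact: gf.
Qed.

End law_of_record.

(** * The heights at a fixed time *)

Section heights_as_chain.
Context {R : realType}.

Definition coordinate (n : int) (w : Omega R) : life R := w n.

Lemma measurable_coordinate n : measurable_fun setT (coordinate n).
Proof.
move=> _ A mA; rewrite setTI; apply: sub_sigma_algebra.
by exists n => //; exists A => //; rewrite setTI.
Qed.

HB.instance Definition _ n :=
  isMeasurableFun.Build _ _ _ _ (coordinate n) (measurable_coordinate n).

Definition coordinate_mfun (n : int) : {mfun Omega R >-> life R} := coordinate n.

Fixpoint backward_times (n : nat) : seq int :=
  if n is m.+1 then m%:Z :: backward_times m else [::].

Lemma backward_timesE n w : [seq coordinate_mfun j w | j <- backward_times n] = history w n.
Proof. by elim: n => //= n ->. Qed.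

Lemma uniq_backward_times n : uniq (backward_times n).
Proof.
have lt m j : j \in backward_times m -> j < m%:Z.
  elim: m => //= m IH; rewrite inE => /orP[/eqP ->|/IH]; first by rewrite ltz_nat.
  by move/lt_trans; apply; rewrite ltz_nat.
elim: n => //= n ->; rewrite andbT; apply/negP => /lt.
by rewrite ltxx.
Qed.

Definition height_chain (f : R -> R) n w :=
  chain coordinate_mfun brood residual f (backward_times n) w.

Lemma measurable_height_chain f n : measurable_fun setT f ->
  measurable_fun setT (height_chain f n).
Proof.
move=> mf; apply: measurable_chain => //; first exact: measurable_brood.
exact: measurable_residual.
Qed.

Lemma foldl_step_scan (f : R -> R) (ls : seq (life R)) r x c :
  let s := foldl (step brood residual f) (r, x, c) ls in
  let Y := scan r [seq progeny l | l <- ls] in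
  s.1.2 = x + \sum_(nu <- Y) f (pm_sup nu) /\ s.2 = (c + size Y)%N.
Proof.
elim: ls r x c => [|l ls IH] r x c /=; first by rewrite big_nil addr0 addn0.
rewrite {2 4}/step /=; case: ifP => _; last exact: IH.
have [-> ->] := IH 0%N (x + f (residual r l)) c.+1.
rewrite size_rcons -cats1 big_cat big_seq1 addSnnS; split=> //=.
by rewrite -addrA (addrC (f _)).
Qed.

Lemma chain_count f n w : (height_chain f n w).2%:R = genea_height w n.
Proof.
rewrite /height_chain /chain /run backward_timesE genea_heightE.
by have [_ ->] := foldl_step_scan f (history w n) 0 0 0.
Qed.

Lemma chain_sum (m0 : R) n w : (height_chain (fun y => y - m0) n w).1.2 =
  chron_height w n - m0 * genea_height w n.
Proof.
rewrite /height_chain /chain /run backward_timesE genea_heightE /chron_height spine_scan.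
have [-> _] := foldl_step_scan (fun y => y - m0) (history w n) 0 0 0.
by rewrite add0r sumrB /pi_seq big_const_seq count_predT iter_addr_0 mulr_natr.
Qed.

Lemma measurable_height_deviation (m0 : R) n :
  measurable_fun setT (fun w => chron_height w n - m0 * genea_height w n).
Proof.
rewrite (_ : (fun w => _) = (fun w => (height_chain (fun y => y - m0) n w).1.2)); last first.
  by apply/funext => w; rewrite chain_sum.
apply: (measurableT_comp measurable_snd); apply: (measurableT_comp measurable_fst).
by apply: measurable_height_chain; exact: measurable_funB.
Qed.

Lemma measurable_genea_height n : measurable_fun setT (fun w => genea_height w n : R).
Proof.
rewrite (_ : (fun w => _) = (fun w => (height_chain id n w).2%:R)); last first.
  by apply/funext => w; rewrite chain_count.
apply: (@measurableT_comp _ _ _ _ _ _ (fun k => k%:R : R)) => //.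
apply: (measurableT_comp measurable_snd).
by apply: measurable_height_chain; exact: measurable_id.
Qed.

End heights_as_chain.

Section one_law.
Context dX (TX : measurableType dX) dY (TY : measurableType dY) (R : realType).
Variables (QX : probability TX R) (X : {mfun TX >-> life R}).
Variables (QY : probability TY R) (Y : {RV QY >-> R}).
Hypothesis offspring01 :
  (0 < 'E_QX[fun w => (pm_mass (progeny (X w)))%:R] <= 1)%E.
Hypothesis lawY : has_law_Ystar QX X Y.
Hypothesis EYfin : ('E_QY[Y] < +oo)%E.

Let measurable_lt0 : measurable [set w | Y w < 0].
Proof.
rewrite -[X in measurable X]setTI (_ : [set w | _] = Y @^-1` `]-oo, 0[).
  by apply: (measurable_funPT Y) => //; exact: measurable_itv.
by apply/seteqP; split=> w /=; rewrite in_itv.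
Qed.

(** The law of [Ystar] is only given through bounded test functions; the indicator of
the negative half-line shows that [E Ystar < +oo] is genuine integrability. *)
Lemma Ystar_lt0_null : QY [set w | Y w < 0] = 0%E.
Proof.
pose f : R -> R := \1_[set y | y < 0].
have mneg : measurable [set y : R | y < 0].
  rewrite (_ : [set y | _] = `]-oo, 0[%classic); first exact: measurable_itv.
  by apply/seteqP; split=> y /=; rewrite in_itv.
have mf : measurable_fun setT f by exact: measurable_indic.
have fb : exists M, forall y, `|f y| <= M.
  by exists 1 => y; rewrite /f indicE; case: (_ \in _); rewrite ?normr1 ?normr0.
have := lawY mf fb; rewrite [RHS]eseries0 => [h|k _ _]; last first.
  rewrite big1 // => r _; rewrite /cond_exp_event integral0_eq ?mul0r ?mulr0 ?mul0r//.
  move=> w _; rewrite /f indicE memNset//= pm_sup_upsilon.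
  by apply/negP; rewrite -leNgt nth_atoms_ge0.
rewrite -h.
by rewrite unlock -(setIT [set w | Y w < 0]) -integral_indic.
Qed.

Lemma Ystar_integrable : QY.-integrable setT (EFin \o Y).
Proof.
have mY : measurable_fun setT (EFin \o Y) by exact/measurable_EFinP.
apply/integrableP; split => //.
rewrite (@ae_eq_integral _ _ _ QY setT (EFin \o Y))//.
- by move: EYfin; rewrite unlock.
- exact: measurableT_comp.
exists [set w | Y w < 0]; split => //.
- exact: Ystar_lt0_null.
- move=> w /= h; rewrite ltNge; apply/negP => Y0; apply: h => _.
  by rewrite /= ger0_norm.
Qed.

Let m0 : R := fine 'E_QY[Y]%E.
Let Z w := Y w - m0.

Definition clip (M z : R) : R := Num.max (- M) (Num.min z M).
Definition excess (M z : R) : R := Num.max (`|z| - M) 0.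

Lemma excess_ge0 M z : 0 <= excess M z.
Proof. by rewrite /excess le_max lexx orbT. Qed.

Lemma clip_excess M z : 0 < M -> `|z - clip M z| <= excess M z.
Proof.
move=> M0; rewrite /clip /excess; have [zM|Mz] := leP z M.
  have [Mz|zM'] := leP (- M) z; first by rewrite subrr normr0 le_max lexx orbT.
  rewrite le_max; apply/orP; left.
  rewrite opprK (ler0_norm (_ : z <= 0)); last lra.
  by rewrite ler0_norm; lra.
have -> : Num.max (- M) M = M by apply/max_idPr; lra.
rewrite le_max; apply/orP; left.
by rewrite !gtr0_norm; lra.
Qed.

Lemma clip_bound M z : 0 < M -> - M <= clip M z <= M.
Proof.
move=> M0; rewrite /clip le_max lexx/= ge_max; apply/andP; split; first lra.
by rewrite ge_min lexx orbT.
Qed.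

Lemma measurable_clip M : measurable_fun setT (clip M).
Proof. by apply: measurable_maxr => //; apply: measurable_minr. Qed.

Lemma measurable_excess M : measurable_fun setT (excess M).
Proof.
apply: measurable_maxr => //; apply: measurable_funB => //.
Qed.

(** [clip] rescaled to take values in [0, 1], as [centered_potential] requires. *)
Definition unit_clip (M y : R) : R := (clip M (y - m0) + M) / (2 * M).

Lemma unit_clip01 M y : 0 < M -> 0 <= unit_clip M y <= 1.
Proof.
move=> M0; have /andP[h1 h2] := clip_bound (y - m0) M0.
rewrite /unit_clip divr_ge0 ?ler_pdivrMr ?mul1r; lra.
Qed.

Lemma measurable_unit_clip M : measurable_fun setT (unit_clip M).
Proof.
apply: measurable_funM => //; apply: measurable_funD => //.
apply: (measurableT_comp (measurable_clip M)); exact: measurable_funB.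
Qed.

Let mY : measurable_fun setT Y. Proof. exact: measurable_funPT. Qed.

Lemma centered_Ystar_integrable : QY.-integrable setT (EFin \o Z).
Proof.
rewrite (_ : _ \o _ = (fun w => (Y w)%:E - m0%:E)%E)//.
apply: integrableB => //; first exact: Ystar_integrable.
exact: finite_measure_integrable_cst.
Qed.

Lemma mean_centered_Ystar : \int[QY]_w Z w = 0.
Proof.
rewrite /Z RintegralB//; last 2 first.
- exact: Ystar_integrable.
- exact: finite_measure_integrable_cst.
rewrite Rintegral_cst//= probability_setT/= mulr1 /Rintegral /m0 unlock.
by rewrite subrr.
Qed.

Lemma excess_integrable M : 0 < M -> QY.-integrable setT (EFin \o (excess M \o Z)).
Proof.
move=> M0; apply: (le_integrable measurableT _ _ centered_Ystar_integrable) => //.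
  apply/measurable_EFinP; apply: (measurableT_comp (measurable_excess M)).
  exact: measurable_funB.
move=> w _ /=; rewrite lee_fin ger0_norm ?excess_ge0// /excess ge_max normr_ge0 andbT.
by rewrite lerBlDr lerDl ltW.
Qed.

Lemma unit_clip_integrable M : 0 < M ->
  QY.-integrable setT (EFin \o (unit_clip M \o Y)).
Proof.
move=> M0; apply: measurable_bounded_integrable => //.
- by rewrite (le_lt_trans (probability_le1 _ _)) ?ltry.
- exact: (measurableT_comp (measurable_unit_clip M)).
exists 1; split=> // N N1 w _ /=; have /andP[h0 h1] := unit_clip01 (Y w) M0.
by rewrite ger0_norm// (le_trans h1)// ltW.
Qed.

Let D M := \int[QY]_w excess M (Z w).
Let e M := \int[QY]_w unit_clip M (Y w).

Lemma mean_unit_clip01 M : 0 < M -> 0 <= e M <= 1.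
Proof.
move=> M0; apply/andP; split.
  by apply: Rintegral_ge0 => w _; case/andP: (unit_clip01 (Y w) M0).
have -> : 1 = \int[QY]_w (fun=> 1) w :> R.
  by rewrite Rintegral_cst//= probability_setT/= mulr1.
apply: le_Rintegral => //.
- exact: unit_clip_integrable.
- exact: finite_measure_integrable_cst.
- by move=> w _; case/andP: (unit_clip01 (Y w) M0).
Qed.

(** The clipped variable is nearly centred: its mean is minus that of what was
clipped. *)
Lemma mean_clip_bound M : 0 < M -> `|2 * M * e M - M| <= D M.
Proof.
move=> M0.
have iu := unit_clip_integrable M0; have ie := excess_integrable M0.
have iZ := centered_Ystar_integrable.
have i2 : QY.-integrable setT (EFin \o (fun w => 2 * M * unit_clip M (Y w))).
  rewrite (_ : _ \o _ = (fun w => (2 * M)%:E * (EFin \o (unit_clip M \o Y)) w)%E)//.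
  exact: integrableZl.
have iM : QY.-integrable setT (EFin \o (fun=> M : R)).
  exact: finite_measure_integrable_cst.
have ic : QY.-integrable setT (EFin \o (fun w => 2 * M * unit_clip M (Y w) - M)).
  rewrite (_ : _ \o _ = (EFin \o (fun w => 2 * M * unit_clip M (Y w))%R)
    \- (EFin \o (fun=> M)))%E//.
  exact: integrableB.
have id_ : QY.-integrable setT
    (EFin \o (fun w => Z w - (2 * M * unit_clip M (Y w) - M))).
  rewrite (_ : _ \o _ = (EFin \o Z)
    \- (EFin \o (fun w => 2 * M * unit_clip M (Y w) - M)%R))%E//.
  exact: integrableB.
have cE y : 2 * M * unit_clip M y - M = clip M (y - m0).
  by rewrite /unit_clip; field; rewrite gt_eqF.
have kE : 2 * M * e M - M = \int[QY]_w (2 * M * unit_clip M (Y w) - M).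
  by rewrite RintegralB// RintegralZl// Rintegral_cst//= probability_setT/= mulr1.
have h w : `|Z w - (2 * M * unit_clip M (Y w) - M)| <= excess M (Z w).
  by rewrite cE; exact: clip_excess.
have -> : 2 * M * e M - M = - \int[QY]_w (Z w - (2 * M * unit_clip M (Y w) - M)).
  by rewrite RintegralB// mean_centered_Ystar sub0r opprK.
rewrite normrN; apply: (le_trans (le_normr_Rintegral _ id_)) => //.
apply: le_Rintegral => //; exact: (integrable_norm id_).
Qed.

Lemma total_unit_clip M : 0 < M ->
  (total_reward (life_law QX X) brood (fun r l => (unit_clip M (residual r l))%:E)
     <= \int[life_law QX X]_l (brood l)%:R%:E * (e M)%:E)%E.
Proof.
move=> M0; have iu := unit_clip_integrable M0.
have -> : ((e M)%:E = 'E_QY[unit_clip M \o Y])%E.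
  by rewrite unlock /e /Rintegral fineK//; exact: integrable_fin_num.
apply: (@total_reward_le _ _ _ _ _ QX X QY Y offspring01 lawY (unit_clip M)).
  exact: measurable_unit_clip.
by move=> y; case/andP: (unit_clip01 y M0).
Qed.

Lemma total_unit_clip_compl M : 0 < M ->
  (total_reward (life_law QX X) brood
      (fun r l => (1 - unit_clip M (residual r l))%:E)
     <= \int[life_law QX X]_l (brood l)%:R%:E * (1 - e M)%:E)%E.
Proof.
move=> M0; have iu := unit_clip_integrable M0.
have -> : ((1 - e M)%:E = 'E_QY[(fun y => 1 - unit_clip M y)%R \o Y])%E.
  rewrite unlock EFinB /e /Rintegral fineK; last exact: integrable_fin_num.
  have i1 : QY.-integrable setT (EFin \o (fun=> 1 : R)).
    exact: finite_measure_integrable_cst.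
  apply: esym; apply: (etrans (integralB measurableT i1 iu)).
  by congr (_ - _)%E; exact: integral_cst1.
apply: (@total_reward_le _ _ _ _ _ QX X QY Y offspring01 lawY
  (fun y => 1 - unit_clip M y)).
  by apply: measurable_funB => //; exact: measurable_unit_clip.
by move=> y; rewrite subr_ge0; case/andP: (unit_clip01 y M0).
Qed.

Lemma total_excess M : 0 < M ->
  (total_reward (life_law QX X) brood
      (fun r l => (excess M (residual r l - m0))%:E) <= (D M)%:E)%E.
Proof.
move=> M0; have ie := excess_integrable M0.
have DE : ((D M)%:E = 'E_QY[(fun y => excess M (y - m0))%R \o Y])%E.
  by rewrite unlock /D /Rintegral fineK//; exact: integrable_fin_num.
apply: (@le_trans _ _ (\int[life_law QX X]_l (brood l)%:R%:E * (D M)%:E)%E).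
  rewrite DE; apply: (@total_reward_le _ _ _ _ _ QX X QY Y offspring01 lawY
    (fun y => excess M (y - m0))) => [|y]; last exact: excess_ge0.
  by apply: (measurableT_comp (measurable_excess M)); exact: measurable_funB.
rewrite -[leRHS]mul1e; apply: lee_wpmul2r; last exact: mean_brood_le1.
by rewrite lee_fin; apply: Rintegral_ge0 => w _; exact: excess_ge0.
Qed.

Section heights.
Variable P : probability (Omega R) R.
Hypothesis iid : iid_as P (fun n w => w n) QX X.

Lemma indep_coordinate (s : seq int) (A : int -> set (life R)) : uniq s ->
  (forall n, measurable (A n)) ->
  P (\bigcap_(n in [set` s]) (coordinate_mfun n @^-1` A n)) =
    (\prod_(n <- s) life_law QX X (A n))%E.
Proof.
case: iid => prodP lawP us mA; rewrite prodP//.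
by apply: eq_bigr => n _; rewrite lawP.
Qed.

(** [Ystar - m0] is split into the centred clipped part, a constant bounded by [D M]
and an error bounded by the excess.  The threshold is shared equally between
the three parts. *)
Lemma height_deviation n K M lam : 0 < M -> 0 < lam -> K%:R * D M <= lam / 3 ->
  (P [set w | (genea_height w n <= K%:R /\
               lam < `|chron_height w n - m0 * genea_height w n|)%R] <=
   (72 * M ^+ 2 * K.+2%:R / lam ^+ 2 + 3 * K.+1%:R * D M / lam)%:E)%E.
Proof.
move=> M0 lam0 KD.
pose a y := unit_clip M y - e M; pose b y := excess M (y - m0).
have D0 : 0 <= D M by apply: Rintegral_ge0 => w _; exact: excess_ge0.
have mb : measurable_fun setT b.
  by apply: (measurableT_comp (measurable_excess M)); exact: measurable_funB.
have muc := measurable_unit_clip M.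
have ma : measurable_fun setT a by exact: measurable_funB.
have mbr := @measurable_brood R; have mres := @measurable_residual R.
have mean1 := mean_brood_le1 offspring01.
have ut := uniq_backward_times n.
have lam1 : 0 < lam / (6 * M) by rewrite divr_gt0// mulr_gt0.
have lam2 : 0 < lam / 3 by rewrite divr_gt0.
have := centered_deviation indep_coordinate mbr mres mean1 K ut muc
  (fun y => unit_clip01 y M0) (mean_unit_clip01 M0) lam1
  (total_unit_clip M0) (total_unit_clip_compl M0).
have := nonneg_deviation indep_coordinate mbr mres K ut mb
  (fun y => excess_ge0 M (y - m0)) lam2 D0 (total_excess M0).
set A2 := [set w | _]; set A1 := [set w | _]; set A := [set w | _] => P2 P1.
have mx f : measurable_fun setT f -> measurable_fun setT (fun w => (height_chain f n w).1.2).
  move=> mf; apply: (measurableT_comp measurable_snd).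
  by apply: (measurableT_comp measurable_fst); exact: measurable_height_chain.
have mA1 : measurable A1 by apply: measurable_chain_deviation => //; exact: mx.
have mA2 : measurable A2 by apply: measurable_chain_deviation => //; exact: mx.
have AE : A = [set w | ((height_chain (fun y => y - m0)%R n w).2 <= K)%N /\
    lam < `|(height_chain (fun y => y - m0) n w).1.2|].
  apply/seteqP; split=> w /= []; rewrite chain_sum => h1 h2; split=> //; move: h1;
    by rewrite -(chain_count (fun y => y - m0)) ler_nat.
have mA : measurable A.
  rewrite AE; apply: measurable_chain_deviation => //; first exact: measurable_funB.
  by apply: mx; exact: measurable_funB.
have sub : A `<=` A1 `|` A2.
  rewrite AE => w /= [cK xl].
  have kb : `|2 * M * e M - M| <= D M by exact: mean_clip_bound.
  have H y : `|(y - m0) - (2 * M * a y + (2 * M * e M - M))| <= b y.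
    rewrite /a /b (_ : 2 * M * _ + _ = clip M (y - m0)); first exact: clip_excess.
    by rewrite /unit_clip; field; rewrite gt_eqF.
  have [ca cb hx] := chain_split coordinate_mfun brood residual (backward_times n) w H.
  rewrite -!/(height_chain _ n w) in ca cb hx.
  have [h1|h1] := ltP (lam / (6 * M)) `|(height_chain a n w).1.2|.
    by left; split=> //; rewrite -/(height_chain a n w) -ca.
  right; split; first by rewrite -/(height_chain b n w) -cb.
  rewrite -/(height_chain b n w); move: xl hx cK {ca cb}; set x := (height_chain _ n w).1.2.
  set c := (height_chain _ n w).2; set xa := (height_chain a n w).1.2 in h1 *.
  set xb := (height_chain b n w).1.2 => xl hx cK.
  set k := 2 * M * e M - M in kb hx.
  have h2 : `|2 * M * xa| <= lam / 3.
    rewrite normrM gtr0_norm ?mulr_gt0//.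
    apply: (@le_trans _ _ (2 * M * (lam / (6 * M)))); first by rewrite ler_wpM2l// mulr_ge0// ltW.
    by rewrite le_eqVlt; apply/orP; left; apply/eqP; field; rewrite gt_eqF.
  have h3 : `|k * c%:R| <= lam / 3.
    rewrite normrM (ger0_norm (_ : 0 <= c%:R))//; apply: le_trans KD.
    by rewrite mulrC ler_pM// ler_nat.
  have h4 : `|x| <= `|x - (2 * M * xa + k * c%:R)| + `|2 * M * xa| + `|k * c%:R|.
    rewrite -addrA; apply: le_trans (lerD (lexx _) (ler_normD _ _)).
    by apply: le_trans (ler_normD _ _); rewrite subrK.
  apply: lt_le_trans (ler_norm _); lra.
apply: (@le_trans _ _ (P (A1 `|` A2))); first by apply: le_measure; rewrite ?inE//; exact: measurableU.
apply: (le_trans (measureU2 _ _ _)) => //.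
apply: (le_trans (leeD P1 P2)); rewrite -EFinD lee_fin le_eqVlt; apply/orP; left.
by apply/eqP; field; rewrite !gt_eqF.
Qed.

End heights.
End one_law.

(** * Limits of the truncation and convergence in distribution *)

(** A bounded continuous [f] is close to [f 0] near [0], and bounded on the event of
small probability. *)
Lemma cvg_probability_distribution0 (R : realType)
    (d : nat -> measure_display) (T : forall p, measurableType (d p))
    (P : forall p, probability (T p) R) (X : forall p, T p -> R) :
  (forall p, (1 <= p)%N -> measurable_fun setT (X p)) ->
  (forall eta kappa : R, 0 < eta -> 0 < kappa -> \forall p \near \oo,
     (P p [set w | (eta < `|X p w|)%R] <= kappa%:E)%E) ->
  cvg_in_distribution P X \d_(0 : R).
Proof.
move=> mX cvX f cf [B fB].
have mf : measurable_fun setT f by exact: continuous_measurable_fun.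
have B0 : 0 <= B by apply: le_trans (fB 0).
rewrite integral_dirac//; last exact/measurable_EFinP.
rewrite diracT mul1e.
have ifX p : (1 <= p)%N -> (P p).-integrable setT (EFin \o (f \o X p)).
  move=> p1; apply: measurable_bounded_integrable => //.
  - by rewrite (le_lt_trans (probability_le1 _ _)) ?ltry.
  - by apply: measurableT_comp => //; exact: mX.
  - by exists B; split; [exact: num_real|move=> N BN w _ /=]; rewrite (le_trans (fB _))// ltW.
apply/fine_cvgP; split.
  near=> p; rewrite unlock; apply: integrable_fin_num => //; apply: ifX.
  by near: p; exists 1%N.
apply/cvgrPdist_le => /= e e0.
have /cvgrPdist_le /(_ (e / 2)) := cf 0.
rewrite divr_gt0// => /(_ isT) /nbhs_normP[eta /= eta0 heta].
have e4 : 0 < e / (4 * (B + 1)) by rewrite divr_gt0// mulr_gt0// ltr_wpDl.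
near=> p.
have p1 : (1 <= p)%N by near: p; exists 1%N.
have mXp := mX p p1.
have hP : (P p [set w | (eta / 2 < `|X p w|)%R] <= (e / (4 * (B + 1)))%:E)%E.
  by near: p; apply: cvX => //; rewrite divr_gt0.
set A := [set w | _] in hP.
have mA : measurable A.
  rewrite (_ : A = (fun w => `|X p w|) @^-1` `]eta / 2, +oo[).
    rewrite -[X in measurable X]setTI.
    by apply: (measurableT_comp (@normr_measurable R setT) mXp).
  by apply/seteqP; split=> w /=; rewrite in_itv/= andbT.
have if0 : (P p).-integrable setT (EFin \o (fun=> f 0)).
  exact: finite_measure_integrable_cst.
have icst : (P p).-integrable setT (EFin \o (fun=> e / 2)).
  exact: finite_measure_integrable_cst.
have iA : (P p).-integrable setT (EFin \o (fun w => 2 * B * \1_A w)).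
  apply: measurable_bounded_integrable => //.
  - by rewrite (le_lt_trans (probability_le1 _ _)) ?ltry.
  - by apply: measurable_funM => //; exact: measurable_indic.
  exists (2 * B); split; [exact: num_real|move=> N BN w _ /=]; apply: le_trans (ltW BN).
  by rewrite indicE; case: (_ \in _); rewrite ?mulr1 ?mulr0 ?normr0 ?mulr_ge0// ger0_norm// mulr_ge0.
have iAA : (P p).-integrable setT (EFin \o \1_A).
  exact: integrable_indic.
have idf : (P p).-integrable setT (EFin \o (fun w => f 0 - f (X p w))).
  rewrite (_ : _ \o _ = ((EFin \o (fun=> f 0)%R) \- (EFin \o (f \o X p)))%E)//.
  by apply: integrableB => //; exact: ifX.
have isum : (P p).-integrable setT (EFin \o (fun w => e / 2 + 2 * B * \1_A w)).
  rewrite (_ : _ \o _ = ((EFin \o (fun=> e / 2)%R) \+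
     (EFin \o (fun w => 2 * B * \1_A w)%R))%E)//.
  exact: integrableD.
rewrite /=.
have -> : f 0 - fine ('E_(P p)[f \o X p])%E = \int[P p]_w (f 0 - f (X p w)).
  rewrite RintegralB//; last exact: ifX.
  by rewrite Rintegral_cst//= probability_setT/= mulr1 unlock.
apply: (le_trans (le_normr_Rintegral _ idf)) => //.
apply: (@le_trans _ _ (\int[P p]_w (e / 2 + 2 * B * \1_A w))).
  apply: le_Rintegral => //; first exact: (integrable_norm idf).
  move=> w _; rewrite indicE; have [wA|wA] := boolP (w \in A).
    rewrite mulr1; apply: (@le_trans _ _ (2 * B)); last by rewrite lerDr ltW// divr_gt0.
    apply: (le_trans (ler_normB _ _)); rewrite mulr_natl mulr2n.
    by apply: lerD; exact: fB.
  rewrite mulr0 addr0; apply: heta => /=; rewrite sub0r normrN.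
  move: wA; rewrite notin_setE /A /= => /negP; rewrite -leNgt => h.
  by apply: le_lt_trans h _; rewrite ltr_pdivrMr// ltr_pMr// ltr1n.
rewrite RintegralD// Rintegral_cst//= probability_setT/= mulr1 RintegralZl//.
have -> : \int[P p]_w \1_A w = fine (P p A).
  by rewrite /Rintegral integral_indic// setIT.
have PA : fine (P p A) <= e / (4 * (B + 1)).
  by rewrite -lee_fin fineK// fin_num_measure.
have : 2 * B * fine (P p A) <= 2 * B * (e / (4 * (B + 1))).
  by rewrite ler_wpM2l// mulr_ge0.
have : 2 * B * (e / (4 * (B + 1))) <= e / 2.
  have -> : 2 * B * (e / (4 * (B + 1))) = e / 2 * (B / (B + 1)).
    by field; rewrite gt_eqF// ltr_wpDl.
  by rewrite ler_piMr ?divr_ge0 ?ltW// ltr_pdivrMr ?ltr_wpDl// mul1r ltrDl.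
lra.
Unshelve. all: by end_near.
Qed.

Section excess_of_centered.
Context d (T : measurableType d) (R : realType) (Q : probability T R) (Z : T -> R).
Hypothesis iZ : Q.-integrable setT (EFin \o Z).

Let mZ : measurable_fun setT Z.
Proof. by apply/measurable_EFinP; case/integrableP: iZ. Qed.

Lemma excess_le_norm (M z : R) : 0 < M -> excess M z <= `|z|.
Proof. by move=> M0; rewrite /excess ge_max normr_ge0 andbT; lra. Qed.

Lemma integrable_of_le_norm (g : R -> R) : measurable_fun setT g ->
  (forall z, `|g z| <= `|z|) -> Q.-integrable setT (EFin \o (g \o Z)).
Proof.
move=> mg gz; apply: (le_integrable measurableT _ _ iZ) => //.
  by apply/measurable_EFinP; exact: measurableT_comp.
by move=> w _ /=; rewrite lee_fin.
Qed.

Lemma pos_part_integrable : Q.-integrable setT (EFin \o (fun w => Num.max (Z w) 0)).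
Proof.
apply: (@integrable_of_le_norm (fun z => Num.max z 0)); first exact: measurable_maxr.
by move=> z; have [z0|z0] := leP z 0; rewrite ?normr0 ?normr_ge0.
Qed.

Lemma min_norm_integrable M : 0 < M ->
  Q.-integrable setT (EFin \o (fun w => Num.min `|Z w| M)).
Proof.
move=> M0; apply: (@integrable_of_le_norm (fun z => Num.min `|z| M)).
  by apply: measurable_minr => //; exact: normr_measurable.
by move=> z; rewrite ger0_norm ?ge_min ?lexx// le_min normr_ge0 ltW.
Qed.

(** For a centred variable [E|Z| = 2 E Z^+], so the mean excess is expressed through
the two functionals whose limits are known. *)
Lemma mean_excessE M : 0 < M -> \int[Q]_w Z w = 0 ->
  \int[Q]_w excess M (Z w) =
  2 * (\int[Q]_w Num.max (Z w) 0) - \int[Q]_w Num.min `|Z w| M.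
Proof.
move=> M0 Z0; have ip := pos_part_integrable; have im := min_norm_integrable M0.
have i2p : Q.-integrable setT (EFin \o (fun w => 2 * Num.max (Z w) 0)).
  rewrite (_ : _ \o _ = (fun w => 2%:E * (EFin \o (fun w => Num.max (Z w) 0)%R) w)%E)//.
  exact: integrableZl.
have i3 : Q.-integrable setT (EFin \o (fun w => 2 * Num.max (Z w) 0 - Z w)).
  rewrite (_ : _ \o _ = ((EFin \o (fun w => 2 * Num.max (Z w) 0)%R) \- (EFin \o Z))%E)//.
  exact: integrableB.
transitivity (\int[Q]_w ((2 * Num.max (Z w) 0 - Z w) - Num.min `|Z w| M)).
  apply: eq_Rintegral => w _; rewrite /excess.
  have -> : 2 * Num.max (Z w) 0 - Z w = `|Z w|.
    have [z0|z0] := leP (Z w) 0; first by rewrite ler0_norm//; lra.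
    by rewrite gtr0_norm//; lra.
  have [h|h] := leP `|Z w| M.
    by rewrite subrr; apply/max_idPr; rewrite subr_le0.
  by apply/max_idPl; rewrite subr_ge0 ltW.
by rewrite RintegralB// RintegralB// RintegralZl// Z0 subr0.
Qed.

Lemma excess_vanish (delta : R) : 0 < delta ->
  exists2 M : R, 0 < M & \int[Q]_w excess M (Z w) <= delta.
Proof.
move=> delta0.
have : (\int[Q]_w (excess n.+1%:R (Z w))%:E @[n --> \oo] --> \int[Q]_w (cst 0%E w))%E.
  apply: (@dominated_cvg _ _ _ Q setT measurableT _ _ (fun w => `|Z w|%:E)) => //.
  - move=> n; apply/measurable_EFinP.
    exact: (measurableT_comp (measurable_excess _)).
  - move=> w _; apply: cvg_near_cst.
    exists (Num.truncn `|Z w|).+1 => // n /= hn; congr (_%:E).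
    apply/max_idPr; rewrite subr_le0; apply/ltW/(lt_le_trans (truncnS_gt _)).
    by rewrite ler_nat leqW.
  - exact: (integrable_norm iZ).
  - move=> n w _; rewrite lee_fin ger0_norm; last exact: excess_ge0.
    exact: excess_le_norm.
rewrite integral0 => /fine_cvgP[_] /cvgrPdist_le /(_ _ delta0) [n _ /(_ n (leqnn n)) /=].
rewrite sub0r normrN => h; exists n.+1%:R => //.
exact: le_trans (ler_norm _) h.
Qed.

End excess_of_centered.

(** Uniform integrability of the [Z p], in the form in which it is used. *)
Lemma excess_uniformly_small (R : realType)
    (d : nat -> measure_display) (T : forall p, measurableType (d p))
    (Q : forall p, probability (T p) R) (Z : forall p, T p -> R)
    (db : measure_display) (Tb : measurableType db) (Qb : probability Tb R)
    (Zb : {RV Qb >-> R}) (delta : R) :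
  (forall p, (1 <= p)%N -> (Q p).-integrable setT (EFin \o Z p)) ->
  (forall p, (1 <= p)%N -> \int[Q p]_w Z p w = 0) ->
  Qb.-integrable setT (EFin \o Zb) -> \int[Qb]_w Zb w = 0 ->
  cvg_in_distribution Q Z (distribution Qb Zb) ->
  'E_(Q p)[fun w => Num.max (Z p w) 0%R]%E @[p --> \oo] -->
    'E_Qb[fun w => Num.max (Zb w) 0%R]%E ->
  0 < delta ->
  exists2 M : R, 0 < M &
    \forall p \near \oo, \int[Q p]_w excess M (Z p w) <= delta.
Proof.
move=> iZ Z0 iZb Zb0 cvd cvp delta0.
have delta2 : 0 < delta / 2 by rewrite divr_gt0.
have [M M0 hM] := excess_vanish iZb delta2.
exists M => //.
pose g (z : R) : R := Num.min `|z| M.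
have g0 z : 0 <= g z by rewrite le_min normr_ge0 ltW.
have cg : continuous g.
  move=> z; apply: (@continuous_min R R (fun z => `|z|) (fun=> M) z).
    exact: norm_continuous.
  exact: cst_continuous.
have gb : exists B, forall z, `|g z| <= B.
  by exists M => z; rewrite ger0_norm// ge_min lexx orbT.
have := cvd g cg gb.
rewrite ge0_integral_distribution//=; last first.
  by apply/measurable_EFinP; exact: continuous_measurable_fun.
rewrite -[X in _ --> X]fineK; last first.
  by apply: integrable_fin_num => //; exact: min_norm_integrable.
move/fine_cvg => cvv.
move: cvp; rewrite -[X in _ --> X]fineK; last first.
  by rewrite unlock; apply: integrable_fin_num => //; exact: pos_part_integrable.
move/fine_cvg => cvu.
have /cvgrPdist_le /(_ _ delta2) h :
    2 * fine 'E_(Q p)[fun w => Num.max (Z p w) 0%R]%E - fine 'E_(Q p)[g \o Z p]%E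
      @[p --> \oo] -->
    2 * fine 'E_Qb[fun w => Num.max (Zb w) 0%R]%E
      - fine (\int[Qb]_w (g (Zb w))%:E)%E.
  by apply: cvgB => //; apply: cvgM => //; exact: cvg_cst.
near=> p.
have p1 : (1 <= p)%N by near: p; exists 1%N.
have : `|2 * (\int[Qb]_w Num.max (Zb w) 0) - \int[Qb]_w Num.min `|Zb w| M -
   (2 * (\int[Q p]_w Num.max (Z p w) 0) - \int[Q p]_w Num.min `|Z p w| M)| <= delta / 2.
  by near: p; move: h; rewrite unlock.
rewrite -mean_excessE// -mean_excessE; [|exact: iZ|by []|exact: Z0].
rewrite ler_norml => /andP[h1 h2]; lra.
Unshelve. all: by end_near.
Qed.

(** * Convergence of the recentred height process *)

Unset Implicit Arguments.

Theorem theorem4p1 (R : realType)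
  (* (V*_p, P*_p) *)
  (dX : nat -> measure_display) (TX : forall p, measurableType (dX p))
  (QX : forall p, probability (TX p) R)
  (X : forall p, {mfun TX p >-> life R})
  (* Y*_p *)
  (dY : nat -> measure_display) (TY : forall p, measurableType (dY p))
  (QY : forall p, probability (TY p) R)
  (Y : forall p, {RV (QY p) >-> R})
  (* P_p *)
  (P : forall p : nat, probability (Omega R) R)
  (eps : nat -> R) (t : R) :
  let offspring p : \bar R :=
    ('E_(QX p)[fun w => (pm_mass (progeny (X p w)))%:R])%E in
  let EY p : R := fine ('E_(QY p)[Y p])%E in
  let Hgen p (w : Omega R) : R :=
    eps p * genea_height w (Num.truncn (p%:R * t)) in
  let Hchron p (w : Omega R) : R :=
    eps p * chron_height w (Num.truncn (p%:R * t)) in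
  (forall p, (1 <= p)%N -> (0 < offspring p <= 1)%E) ->
  offspring p @[p --> \oo] --> 1%E ->
  (forall p, (1 <= p)%N -> iid_as (P p) (fun n w => w n) (QX p) (X p)) ->
  (forall p, (1 <= p)%N -> has_law_Ystar (QX p) (X p) (Y p)) ->
  (forall p, (1 <= p)%N -> 0 < eps p) ->
  eps p @[p --> \oo] --> 0 ->
  0 < t ->
  (forall p, (1 <= p)%N -> ('E_(QY p)[Y p] < +oo)%E) ->
  (exists (db : measure_display) (Tb : measurableType db)
      (Qb : probability Tb R) (Ybar : {RV Qb >-> R}),
    [/\ Qb.-integrable [set: Tb] (EFin \o Ybar),
        'E_Qb[Ybar]%E = 0%E,
        cvg_in_distribution QY (fun p w => Y p w - EY p)
          (distribution Qb Ybar)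
      & 'E_(QY p)[fun w => Num.max (Y p w - EY p)%R 0%R]%E @[p --> \oo]
          --> 'E_Qb[fun w => Num.max (Ybar w) 0%R]%E]) ->
  tight P Hgen ->
  cvg_in_distribution P (fun p w => Hchron p w - EY p * Hgen p w)
    \d_(0 : R).
Proof.
move=> offspring EY Hgen Hchron off _ iid law eps0 epscvg t0 EYfin
  [db [Tb [Qb [Yb [iYb EYb cvd cvp]]]]] tightH.
pose n p := Num.truncn (p%:R * t).
pose dev p (w : Omega R) := chron_height w (n p) - EY p * genea_height w (n p).
have devE p w : Hchron p w - EY p * Hgen p w = eps p * dev p w.
  by rewrite /Hchron /Hgen /dev /n mulrBr mulrCA.
have gmeas p : (1 <= p)%N -> measurable_fun setT (fun w : Omega R => genea_height w (n p) : R).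
  by move=> p1; exact: measurable_genea_height.
have dmeas p : (1 <= p)%N -> measurable_fun setT (dev p).
  by move=> p1; exact: measurable_height_deviation.
apply: cvg_probability_distribution0 => [p p1|eta kappa eta0 kappa0].
  rewrite (_ : (fun w => _) = (fun w => eps p * dev p w)).
    by apply: measurable_funM => //; exact: dmeas.
  by apply/funext => w; exact: devE.
have kappa2 : 0 < kappa / 2 by rewrite divr_gt0.
have [K0 hK0] := tightH _ kappa2.
(* [K1] bounds [eps p] times the number of records off the event of [hK0]; it must
   be positive, and [K0] need not be *)
pose K1 := `|K0| + 1.
have K1_gt0 : 0 < K1 by rewrite ltr_wpDl.
have K1_gt0' : 0 < K1 + 1 by rewrite addr_gt0.
(* The first bound on the mean excess keeps the drift of the clipped part below a
   third of the threshold, the second one makes the excess cost [kappa / 4]. *)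
pose delta := Num.min (eta / (3 * (K1 + 1))) (kappa * eta / (12 * (K1 + 1))).
have delta0 : 0 < delta by rewrite lt_min !divr_gt0 ?mulr_gt0.
have iZ p : (1 <= p)%N -> (QY p).-integrable setT (EFin \o (fun w => Y p w - EY p)).
  by move=> p1; exact: (centered_Ystar_integrable (law p p1) (EYfin p p1)).
have Z0 p : (1 <= p)%N -> \int[QY p]_w (Y p w - EY p) = 0.
  by move=> p1; exact: (mean_centered_Ystar (law p p1) (EYfin p p1)).
have Zb0 : \int[Qb]_w Yb w = 0 by move: EYb; rewrite unlock /Rintegral => ->.
have [M M0 hM] := excess_uniformly_small iZ Z0 iYb Zb0 cvd cvp delta0.
pose c := 72 * M ^+ 2 * (K1 + 2) / eta ^+ 2.
have c0 : 0 < c by rewrite !(mulr_gt0, divr_gt0, invr_gt0, exprn_gt0)// addr_gt0.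
have kc0 : 0 < kappa / (4 * c) by rewrite divr_gt0// mulr_gt0.
have eps_small (x : R) : 0 < x -> \forall p \near \oo, eps p <= x.
  move=> x0; move/cvgrPdist_le : epscvg => /(_ _ x0); apply: filterS => p.
  by rewrite sub0r normrN; exact: le_trans (ler_norm _).
near=> p.
have p1 : (1 <= p)%N by near: p; exists 1%N.
have hMp : \int[QY p]_w excess M (Y p w - EY p) <= delta by near: p.
have ep0 := eps0 p p1.
have ep1 : eps p <= 1 by near: p; exact: eps_small.
have epc : eps p <= kappa / (4 * c) by near: p; exact: eps_small.
set D := \int[QY p]_w excess M (Y p w - EY p) in hMp.
have D0 : 0 <= D by apply: Rintegral_ge0 => w _; exact: excess_ge0.
pose K := Num.truncn (K1 / eps p).
have KK1 : K%:R * eps p <= K1.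
  by rewrite -ler_pdivlMr// truncn_le// divr_ge0// ltW.
have KK1' : K1 < K.+1%:R * eps p by rewrite -ltr_pdivrMr// truncnS_gt.
pose lam := eta / eps p.
have lam0 : 0 < lam by rewrite divr_gt0.
have D1 : D * (3 * (K1 + 1)) <= eta.
  rewrite -ler_pdivlMr ?mulr_gt0//; apply: le_trans hMp _.
  by rewrite ge_min lexx.
have D2 : D * (12 * (K1 + 1)) <= kappa * eta.
  rewrite -ler_pdivlMr ?mulr_gt0//; apply: le_trans hMp _.
  by rewrite ge_min lexx orbT.
have KD : K%:R * D <= lam / 3.
  rewrite /lam ler_pdivlMr// ler_pdivlMr//.
  have := ler_wpM2r D0 KK1; nra.
pose A := [set w : Omega R | genea_height w (n p) <= K%:R /\ lam < `|dev p w|].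
have PA : (P p A <= (72 * M ^+ 2 * K.+2%:R / lam ^+ 2 + 3 * K.+1%:R * D / lam)%:E)%E.
  exact: (height_deviation (off p p1) (law p p1) (EYfin p p1) (iid p p1) (n p) M0 lam0 KD).
have mT : measurable [set w | (K0 < `|Hgen p w|)%R].
  rewrite (_ : [set w | _] = (fun w => `|Hgen p w|) @^-1` `]K0, +oo[).
    rewrite -[X in measurable X]setTI.
    apply: (measurableT_comp (@normr_measurable R setT)) => //.
    by apply: measurable_funM => //; exact: gmeas.
  by apply/seteqP; split=> w /=; rewrite in_itv/= andbT.
have mA : measurable A.
  rewrite (_ : A = (fun w => genea_height w (n p)) @^-1` `]-oo, K%:R] `&`
     (fun w => `|dev p w|) @^-1` `]lam, +oo[); last first.
    by apply/seteqP; split=> w [h1 h2]; split=> /=; move: h1 h2; rewrite /= !in_itv/= ?andbT.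
  apply: measurableI; rewrite -[X in measurable X]setTI; first exact: gmeas.
  by apply: (measurableT_comp (@normr_measurable R setT)) => //; exact: dmeas.
have mB : measurable [set w | (eta < `|(Hchron p w - EY p * Hgen p w)%R|)%R].
  rewrite (_ : [set w | _] = (fun w => `|eps p * dev p w|) @^-1` `]eta, +oo[).
    rewrite -[X in measurable X]setTI.
    apply: (measurableT_comp (@normr_measurable R setT)) => //.
    by apply: measurable_funM => //; exact: dmeas.
  by apply/seteqP; split=> w /=; rewrite in_itv/= andbT devE.
apply: (@le_trans _ _ (P p ([set w | (K0 < `|Hgen p w|)%R] `|` A))).
  apply: le_measure; rewrite ?inE//; first exact: measurableU.
  move=> w /=; rewrite devE => hw.
  have [gK|Kg] := leP (genea_height w (n p)) K%:R.
    right; split=> //; rewrite /lam ltr_pdivrMr// mulrC.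
    by move: hw; rewrite normrM (gtr0_norm ep0).
  left; rewrite /Hgen -/(n p).
  (* heights are integers *)
  have Kg' : K.+1%:R <= genea_height w (n p).
    by move: Kg; rewrite genea_heightE ltr_nat ler_nat.
  apply: (@lt_le_trans _ _ (eps p * genea_height w (n p))); last exact: ler_norm.
  apply: (@lt_le_trans _ _ (eps p * K.+1%:R)); last by rewrite ler_pM2l.
  apply: (@lt_trans _ _ K1); last by rewrite mulrC.
  by rewrite /K1 (le_lt_trans (ler_norm _))// ltrDl.
apply: (le_trans (measureU2 _ _ _)) => //.
apply: (le_trans (leeD (hK0 p p1) PA)); rewrite -EFinD lee_fin.
have T1 : 72 * M ^+ 2 * K.+2%:R / lam ^+ 2 <= kappa / 4.
  have -> : 72 * M ^+ 2 * K.+2%:R / lam ^+ 2 =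
      72 * M ^+ 2 / eta ^+ 2 * (K.+2%:R * eps p) * eps p.
    by rewrite /lam; field; rewrite !gt_eqF.
  apply: (@le_trans _ _ (c * eps p)).
    apply: ler_wpM2r; first exact: ltW.
    have -> : c = 72 * M ^+ 2 / eta ^+ 2 * (K1 + 2) by rewrite /c; ring.
    apply: ler_wpM2l; first by rewrite divr_ge0 ?mulr_ge0 ?exprn_ge0// ltW.
    by rewrite -natr1 -natr1; lra.
  rewrite mulrC; apply: le_trans (ler_wpM2r (ltW c0) epc) _.
  by rewrite le_eqVlt; apply/orP; left; apply/eqP; field; rewrite gt_eqF.
have T2 : 3 * K.+1%:R * D / lam <= kappa / 4.
  have -> : 3 * K.+1%:R * D / lam = 3 * (K.+1%:R * eps p) * D / eta.
    by rewrite /lam; field; rewrite !gt_eqF.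
  rewrite ler_pdivrMr// -natr1.
  have : (K%:R + 1) * eps p <= K1 + 1 by lra.
  move=> /(ler_wpM2r D0); lra.
lra.
Unshelve. all: by end_near.
Qed.
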